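(* $\Vdash_{\mathbb{Q}}$ “ $\tilde{\mathbf{T}}$ is a $\lambda$--Souslin tree”, where $\tilde{\mathbf{T}}$ is the canonical $\mathbb{Q}$--name for the generic tree, i.e. $\Vdash_{\mathbb{Q}} \tilde{\mathbf{T}}=\bigcup\{T: T\in \tilde{G}_{\mathbb{Q}}\}$.
   Context: Assume: (a) $\lambda$ is a strongly inaccessible Mahlo cardinal; (b) $S\subseteq\{\mu<\lambda:\mu$ strongly inaccessible$\}$ is stationary in $\lambda$; (c) $S_0\subseteq\lambda$ is a set of limit ordinals; (d) for every $\mu\in S$, $\diamondsuit_{S_0\cap\mu}$ holds (there is $\langle\nu_\delta:\delta\in S_0\cap\mu\rangle$ with $\nu_\delta\in{}^{\delta}2$ such that for every $\nu\in{}^{\mu}2$ the set $\{\delta\in S_0\cap\mu:\nu\restriction\delta=\nu_\delta\}$ is stationary in $\mu$). For a limit ordinal $\alpha$, an $\alpha$--tree is $T\subseteq{}^{\alpha>}2$ containing $\langle\rangle$, closed under initial segments, with $\eta\in T\Rightarrow \eta^\frown\langle0\rangle,\eta^\frown\langle1\rangle\in T$, and such that every $\eta\in T$ has extensions in $T$ of every length $\beta$ with $\ell g(\eta)\le\beta<\alpha$. A $\lambda$--Souslin tree is a $\lambda$--tree $T\subseteq{}^{\lambda>}2$ all of whose antichains have size $<\lambda$. For $\beta\le\alpha$ let $T_{[\beta]}=T\cap{}^{\beta}2$, $T_{[<\beta]}=T\cap{}^{\beta>}2$, and for limit $\delta$, $\lim_\delta T_{[<\delta]}=\{\eta\in{}^{\delta}2:(\forall\beta<\delta)(\eta\restriction\beta\in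 T)\}$. $T$ has true height $\alpha$ if every $\eta\in T$ is an initial segment of some $\nu\in{}^{\alpha}2$ with all $\nu\restriction\beta\in T$ ($\beta<\alpha$). The forcing $\mathbb{Q}$: conditions are trees $T\subseteq{}^{\alpha>}2$ of true height $\alpha=\alpha(T)<\lambda$ ($\alpha$ limit) such that $|\lim_\delta(T_{[<\delta]})\setminus T_{[\delta]}|\le 1$ for every limit $\delta<\alpha$; ordered by end-extension: $T_1\le T_2$ iff $T_1=T_2\cap{}^{\alpha(T_1)>}2$ (larger = stronger). *)

(* Defs.v *)
(* Rocq Stdlib, classical logic.

   The ground model is the ambient type theory: ordinals are the elements of an
   arbitrary well-ordered type [W], an ordinal [a : W] standing for the set
   {x | x < a}.  The forcing extension is described through names and the
   forcing relation for the first-order language of set theory. *)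
From Stdlib Require Import Classical ClassicalEpsilon.

Set Implicit Arguments.
Unset Strict Implicit.
Unset Printing Implicit Defensive.

(** * Ordinals *)

Record wellorder : Type := WellOrder {
  wo_car :> Type;
  wo_lt : wo_car -> wo_car -> Prop;
  wo_wf : well_founded wo_lt;
  wo_trans : forall x y z, wo_lt x y -> wo_lt y z -> wo_lt x z;
  wo_total : forall x y, wo_lt x y \/ x = y \/ wo_lt y x
}.

Declare Scope ord_scope.
Delimit Scope ord_scope with ord.
Notation "x < y" := (wo_lt x y) : ord_scope.
Notation "x <= y" := (wo_lt x y \/ x = y) : ord_scope.
Local Open Scope ord_scope.

Definition limit_ord (W : wellorder) (d : W) : Prop :=
  (exists x, x < d) /\ forall x, x < d -> exists y, x < y /\ y < d.

Definition is_succ (W : wellorder) (x y : W) : Prop :=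
  x < y /\ forall z, x < z -> y <= z.

(* For a cardinal [k] this is |A| < k. *)
Definition size_lt (W : wellorder) (X : Type) (A : X -> Prop) (k : W) : Prop :=
  exists b, b < k /\ exists f : X -> W,
    (forall x, A x -> f x < b) /\
    (forall x y, A x -> A y -> f x = f y -> x = y).

(* cf(k) = k for a limit ordinal k *)
Definition regular (W : wellorder) (k : W) : Prop :=
  limit_ord k /\
  forall b, b < k -> forall f : W -> W, (forall x, x < b -> f x < k) ->
    exists c, c < k /\ forall x, x < b -> f x < c.

Definition club (W : wellorder) (k : W) (C : W -> Prop) : Prop :=
  (forall x, C x -> x < k) /\
  (forall x, x < k -> exists y, C y /\ x < y) /\
  (forall d, d < k -> limit_ord d ->
     (forall x, x < d -> exists y, C y /\ x < y /\ y < d) -> C d).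

Definition stationary (W : wellorder) (k : W) (A : W -> Prop) : Prop :=
  forall C, club k C -> exists x, x < k /\ A x /\ C x.

(** * Binary sequences of ordinal length *)

(* [val] is normalised to [false] outside the domain {x | x < lg}, so that
   Leibniz equality is equality of sequences. *)
Record bseq (W : wellorder) : Type := BSeq {
  lg : W;
  val : W -> bool;
  val_out : forall x, ~ x < lg -> val x = false
}.

Lemma restr_out (W : wellorder) (e : bseq W) (b x : W) :
  ~ x < b ->
  (if excluded_middle_informative (x < b) then val e x else false) = false.
Proof. intros H. destruct (excluded_middle_informative (x < b)); tauto. Qed.

Definition restr (W : wellorder) (e : bseq W) (b : W) : bseq W :=
  BSeq (@restr_out W e b).

Definition prefix (W : wellorder) (e n : bseq W) : Prop :=
  lg e <= lg n /\ restr n (lg e) = e.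

(* [n] is [e] followed by the single value [i] *)
Definition is_snoc (W : wellorder) (e : bseq W) (i : bool) (n : bseq W) : Prop :=
  is_succ (lg e) (lg n) /\ prefix e n /\ val n (lg e) = i.

Definition strong_limit (W : wellorder) (k : W) : Prop :=
  forall a, a < k -> size_lt (fun e : bseq W => lg e = a) k.

(* Uncountability is expressed by a limit ordinal below [k], i.e. omega < k. *)
Definition strongly_inaccessible (W : wellorder) (k : W) : Prop :=
  (exists w, w < k /\ limit_ord w) /\ regular k /\ strong_limit k.

Definition Mahlo (W : wellorder) (k : W) : Prop :=
  strongly_inaccessible k /\ stationary k (fun x => regular x).

Definition diamond (W : wellorder) (k : W) (A : W -> Prop) : Prop :=
  exists nu : W -> bseq W,
    (forall d, A d -> lg (nu d) = d) /\
    forall e, lg e = k -> stationary k (fun d => A d /\ restr e d = nu d).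

(** * Trees *)

Definition is_tree (W : wellorder) (a : W) (T : bseq W -> Prop) : Prop :=
  limit_ord a /\
  (forall e, T e -> lg e < a) /\
  (exists e, T e /\ forall x, ~ x < lg e) /\
  (forall e n, T e -> prefix n e -> T n) /\
  (forall e i, T e -> exists n, T n /\ is_snoc e i n) /\
  (forall e b, T e -> lg e <= b -> b < a -> exists n, T n /\ lg n = b /\ prefix e n).

Definition lim_branch (W : wellorder) (T : bseq W -> Prop) (d : W) (e : bseq W) : Prop :=
  lg e = d /\ forall b, b < d -> T (restr e b).

Definition true_height (W : wellorder) (a : W) (T : bseq W -> Prop) : Prop :=
  forall e, T e -> exists n, lim_branch T a n /\ prefix e n.

(** * The forcing notion Q; larger conditions are stronger *)

Record cond (W : wellorder) (lam : W) : Type := Cond {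
  ctree : bseq W -> Prop;
  cht : W;
  cht_lt : cht < lam;
  ctree_tree : is_tree cht ctree;
  ctree_height : true_height cht ctree;
  ctree_omit : forall d, d < cht -> limit_ord d ->
    forall e n, lim_branch ctree d e -> ~ ctree e ->
                lim_branch ctree d n -> ~ ctree n -> e = n
}.

Definition cond_le (W : wellorder) (lam : W) (p q : cond lam) : Prop :=
  forall e, ctree p e <-> ctree q e /\ lg e < cht p.

(** * Formulas of set theory with parameters in [X] *)

Inductive fm (X : Type) : Type :=
| FMem (x y : X)
| FEq (x y : X)
| FNot (f : fm X)
| FAnd (f g : fm X)
| FAll (f : X -> fm X).

Definition FImp (X : Type) (f g : fm X) : fm X := FNot (FAnd f (FNot g)).
Definition FOr (X : Type) (f g : fm X) : fm X := FNot (FAnd (FNot f) (FNot g)).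
Definition FIff (X : Type) (f g : fm X) : fm X := FAnd (FImp f g) (FImp g f).
Definition FEx (X : Type) (f : X -> fm X) : fm X := FNot (FAll (fun x => FNot (f x))).

Declare Scope fm_scope.
Delimit Scope fm_scope with fm.
Bind Scope fm_scope with fm.
Notation "x ∈ y" := (FMem x y) (at level 70) : fm_scope.
Notation "x ≐ y" := (FEq x y) (at level 70) : fm_scope.
Notation "¬ f" := (FNot f) (at level 75, right associativity) : fm_scope.
Notation "f ∧ g" := (FAnd f g) (at level 80, right associativity) : fm_scope.
Notation "f ∨ g" := (FOr f g) (at level 85, right associativity) : fm_scope.
Notation "f ⇒ g" := (FImp f g) (at level 90, right associativity) : fm_scope.
Notation "f ⇔ g" := (FIff f g) (at level 95, no associativity) : fm_scope.
Notation "'ALL' x , f" := (FAll (fun x => f))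
  (at level 200, x name, f at level 200) : fm_scope.
Notation "'EX' x , f" := (FEx (fun x => f))
  (at level 200, x name, f at level 200) : fm_scope.
Notation "'ALL' x ∈ a , f" := (FAll (fun x => FImp (FMem x a) f))
  (at level 200, x name, a at level 69, f at level 200) : fm_scope.
Notation "'EX' x ∈ a , f" := (FEx (fun x => FAnd (FMem x a) f))
  (at level 200, x name, a at level 69, f at level 200) : fm_scope.
Local Open Scope fm_scope.

Definition f_sub (X : Type) (x y : X) : fm X := ALL z ∈ x, (z ∈ y).
Notation "x ⊑ y" := (f_sub x y) (at level 70) : fm_scope.

Definition f_empty (X : Type) (x : X) : fm X := ALL z, ¬ (z ∈ x).

(* z = {x, y} *)
Definition f_upair (X : Type) (z x y : X) : fm X :=
  ALL w, (w ∈ z ⇔ (w ≐ x ∨ w ≐ y)).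

(* z = (x, y), Kuratowski *)
Definition f_opair (X : Type) (z x y : X) : fm X :=
  EX u, EX v, (f_upair u x x ∧ f_upair v x y ∧ f_upair z u v).

(* (x, y) belongs to f *)
Definition f_app (X : Type) (f x y : X) : fm X := EX z ∈ f, f_opair z x y.

(* f is a function with domain a *)
Definition f_fun (X : Type) (f a : X) : fm X :=
  (ALL z ∈ f, EX x ∈ a, EX y, f_opair z x y) ∧
  (ALL x ∈ a, EX y, f_app f x y) ∧
  (ALL x, ALL y, ALL z, (f_app f x y ⇒ f_app f x z ⇒ y ≐ z)).

(* x is 0 or 1 *)
Definition f_bit (X : Type) (x : X) : fm X :=
  f_empty x ∨ (ALL z, (z ∈ x ⇔ f_empty z)).

Definition f_trans (X : Type) (x : X) : fm X := ALL y ∈ x, (y ⊑ x).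

Definition f_limit (X : Type) (a : X) : fm X :=
  f_trans a ∧ (ALL x ∈ a, f_trans x) ∧
  (EX x, (x ∈ a)) ∧ (ALL x ∈ a, EX y ∈ a, (x ∈ y)).

(* e : b -> 2 *)
Definition f_seq (X : Type) (e b : X) : fm X :=
  f_fun e b ∧ (ALL x, ALL y, (f_app e x y ⇒ f_bit y)).

(* e is a binary sequence of length < a; among such sequences "initial
   segment" is inclusion *)
Definition f_node (X : Type) (a e : X) : fm X := EX b ∈ a, f_seq e b.

(* n = e ∪ {(b, i)}; with b the length of e this is e followed by i *)
Definition f_snoc (X : Type) (n e b i : X) : fm X :=
  ALL z, (z ∈ n ⇔ (z ∈ e ∨ f_opair z b i)).

Definition f_tree (X : Type) (a T : X) : fm X :=
  f_limit a ∧
  (ALL e ∈ T, f_node a e) ∧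
  (EX e ∈ T, f_empty e) ∧
  (ALL e ∈ T, ALL n, (f_node a n ⇒ n ⊑ e ⇒ n ∈ T)) ∧
  (ALL e ∈ T, ALL b, (f_seq e b ⇒
     ALL i, (f_bit i ⇒ EX n ∈ T, f_snoc n e b i))) ∧
  (ALL e ∈ T, ALL b, (f_seq e b ⇒
     ALL c ∈ a, (b ⊑ c ⇒ EX n ∈ T, (f_seq n c ∧ e ⊑ n)))).

Definition f_antichain (X : Type) (T A : X) : fm X :=
  A ⊑ T ∧ (ALL e ∈ A, ALL n ∈ A, (e ⊑ n ⇒ e ≐ n)).

(* |A| < a: some injection maps A into some b ∈ a *)
Definition f_size_lt (X : Type) (A a : X) : fm X :=
  EX b ∈ a, EX f, (f_fun f A ∧
    (ALL x, ALL y, (f_app f x y ⇒ y ∈ b)) ∧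
    (ALL x, ALL y, ALL z, (f_app f x z ⇒ f_app f y z ⇒ x ≐ y))).

Definition f_souslin (X : Type) (a T : X) : fm X :=
  f_tree a T ∧ (ALL A, (f_antichain T A ⇒ f_size_lt A a)).

(* T = ⋃ G *)
Definition f_union (X : Type) (T G : X) : fm X :=
  ALL z, (z ∈ T ⇔ EX t ∈ G, (z ∈ t)).

(** * Names and the forcing relation *)

(* [Name nm cd] is the name {(nm i, cd i) | i : I}. *)
Inductive name (P : Type) : Type :=
| Name (I : Type) (nm : I -> name P) (cd : I -> P).

Section Forcing.
Context (P : Type) (le : P -> P -> Prop).

(* p ⊩ a = b iff whenever (s, c) ∈ a and q ≥ p, c one has q ⊩ s ∈ b, and
   symmetrically, where q ⊩ s ∈ b iff the set of r such that r ≥ c and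
   r ⊩ s = t for some (t, c) ∈ b is dense above q.  Membership is inlined and
   the symmetric half is written with the arguments of the recursive call in
   the same order, so that the recursion is structural in the first name. *)
Fixpoint forces_eq (a b : name P) (p : P) {struct a} : Prop :=
  match a, b with
  | Name na ca, Name nb cb =>
      (forall i q, le p q -> le (ca i) q ->
         forall q', le q q' -> exists r, le q' r /\
           exists j, le (cb j) r /\ forces_eq (na i) (nb j) r) /\
      (forall j q, le p q -> le (cb j) q ->
         forall q', le q q' -> exists r, le q' r /\
           exists i, le (ca i) r /\ forces_eq (na i) (nb j) r)
  end.

Definition forces_mem (s b : name P) (p : P) : Prop :=
  match b with
  | Name nb cb =>
      forall q, le p q -> exists r, le q r /\
        exists j, le (cb j) r /\ forces_eq s (nb j) r
  end.

Fixpoint forces (p : P) (f : fm (name P)) {struct f} : Prop :=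
  match f with
  | FMem x y => forces_mem x y p
  | FEq x y => forces_eq x y p
  | FNot g => forall q, le p q -> ~ forces q g
  | FAnd g h => forces p g /\ forces p h
  | FAll g => forall x, forces p (g x)
  end.

Definition forced (f : fm (name P)) : Prop := forall p, forces p f.

End Forcing.

(** * Canonical names *)

(* The name {(s i, p) | i : I, p : P} of the set {s i | i : I}; pairing with
   every condition makes no use of a weakest one. *)
Definition set_name (P I : Type) (s : I -> name P) : name P :=
  Name (fun ip : I * P => s (fst ip)) (fun ip : I * P => snd ip).

Definition upair_name (P : Type) (s t : name P) : name P :=
  set_name (fun b : bool => if b then s else t).

Definition opair_name (P : Type) (s t : name P) : name P :=
  upair_name (upair_name s s) (upair_name s t).

Definition check_bool (P : Type) (b : bool) : name P :=
  let zero := set_name (fun i : Empty_set => match i with end) in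
  if b then set_name (fun _ : unit => zero) else zero.

Definition check_ord (P : Type) (W : wellorder) : W -> name P :=
  Fix (@wo_wf W) (fun _ => name P)
    (fun x rec => set_name (fun y : {y : W | wo_lt y x} =>
                              rec (proj1_sig y) (proj2_sig y))).

Definition check_bseq (P : Type) (W : wellorder) (e : bseq W) : name P :=
  set_name (fun x : {x : W | wo_lt x (lg e)} =>
    opair_name (check_ord P (proj1_sig x)) (check_bool P (val e (proj1_sig x)))).

Definition check_set (P : Type) (W : wellorder) (T : bseq W -> Prop) : name P :=
  set_name (fun e : {e : bseq W | T e} => check_bseq P (proj1_sig e)).

(* {(p̌, p) | p ∈ Q}, with the condition p identified with its tree *)
Definition generic_filter (W : wellorder) (lam : W) : name (cond lam) :=
  Name (fun p : cond lam => check_set (cond lam) (ctree p)) (fun p => p).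

(* {(ě, p) | e ∈ p ∈ Q} *)
Definition generic_tree (W : wellorder) (lam : W) : name (cond lam) :=
  Name (fun pe : {p : cond lam & {e : bseq W | ctree p e}} =>
          check_bseq (cond lam) (proj1_sig (projT2 pe)))
       (fun pe => projT1 pe).

Definition Q_forced (W : wellorder) (lam : W) (f : fm (name (cond lam))) : Prop :=
  forced (@cond_le W lam) f.

(* Main.v *)
(* Given a name A of an antichain, call a node n of a condition u decided if u
   forces an initial segment of n into A, or if no stronger condition forces an
   extension of n into A.  Decided nodes are dense, and by counting conditions
   the heights needed to decide all nodes of a condition of height < mu stay
   below mu for a club of mu, hence for some mu in S.  Iterate mu times, adding
   at each limit level all branches except the one guessed by the diamond, which
   is omitted when none of its proper initial segments is decided; true height
   survives because branches through decided nodes are never omitted.  In the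
   resulting condition of height mu every mu-branch has a decided proper initial
   segment, since an undecided one would have been guessed and omitted.  So
   every element of A has length < mu, and A is contained in the condition. *)
From Stdlib Require Import Classical ClassicalEpsilon FunctionalExtensionality.
Require Import Defs.

Set Implicit Arguments.
Unset Strict Implicit.
Unset Printing Implicit Defensive.
Local Open Scope ord_scope.

(** * Ordinals *)

Section Ordinals.
Context (W : wellorder).
Implicit Types x y z k : W.

(** The obstacle is the union of a chain of conditions: the rule on omitted branches passes to the
    union, but nothing gives it true height, since a branch built along the chain may meet an
    omitted one at some limit. The iteration is therefore stated for an abstract predicate [Kp] of
    branches that a step must keep, and asks that above every node there be a node from which all
    later branches are kept. It is used twice. With [Kp] always true it treats the nodes of one
    condition in fewer than [lam] steps; with [kept] it runs up to [mu]. A diamond guess is one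
    sequence, which matches the single branch that a level may lose. Regularity of [mu] keeps the
    stages below [mu] at limits; closure of [mu] under [ht_bound] keeps them there at each step. The
    combinatorics never mentions names: it treats any monotone relation [AA] between conditions and
    sequences whose elements form an antichain and can be put into the tree. No generic extension is
    built; forced statements are derived in a calculus for the forcing relation, and the size of an
    antichain is bounded by an explicit name for the restriction of a ground model injection. *)

Lemma lt_irrefl x : ~ x < x.
Proof. induction (wo_wf x) as [x _ IH]; intros H; exact (IH x H H). Qed.

Lemma lt_asym x y : x < y -> ~ y < x.
Proof. intros H K; exact (lt_irrefl (wo_trans H K)). Qed.

Lemma le_lt_trans x y z : x <= y -> y < z -> x < z.
Proof. intros [H | ->] K; [exact (wo_trans H K) | exact K]. Qed.

Lemma lt_le_trans x y z : x < y -> y <= z -> x < z.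
Proof. intros H [K | <-]; [exact (wo_trans H K) | exact H]. Qed.

Lemma le_trans x y z : x <= y -> y <= z -> x <= z.
Proof. intros H [K | <-]; [left; exact (le_lt_trans H K) | exact H]. Qed.

Lemma nlt_le x y : ~ x < y -> y <= x.
Proof. intros H; destruct (wo_total x y) as [K | [K | K]]; [tauto | right; auto | left; auto]. Qed.

Lemma le_nlt x y : x <= y -> ~ y < x.
Proof. intros H K; exact (lt_irrefl (le_lt_trans H K)). Qed.

Lemma lt_or_le x y : x < y \/ y <= x.
Proof. destruct (classic (x < y)); [left; auto | right; apply nlt_le; auto]. Qed.

Lemma le_antisym x y : x <= y -> y <= x -> x = y.
Proof. intros [H | H] K; [destruct (le_nlt K H) | exact H]. Qed.

Lemma least (A : W -> Prop) : (exists x, A x) -> exists x, A x /\ forall y, A y -> x <= y.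
Proof.
  intros [x Ax]; revert Ax; induction (wo_wf x) as [x _ IH]; intros Ax.
  destruct (classic (exists y, y < x /\ A y)) as [[y [H K]] | H]; [exact (IH y H K) |].
  exists x; split; [exact Ax |]; intros y Ay; apply nlt_le; intros K; apply H; eauto.
Qed.

Definition is_lub (A : W -> Prop) (s : W) : Prop :=
  (forall x, A x -> x <= s) /\ forall t, (forall x, A x -> x <= t) -> s <= t.

Lemma lub_exists (A : W -> Prop) t : (forall x, A x -> x <= t) -> exists s, is_lub A s.
Proof. intros H; apply (least (A := fun s => forall x, A x -> x <= s)); eauto. Qed.

Lemma lub_unique (A : W -> Prop) s t : is_lub A s -> is_lub A t -> s = t.
Proof. intros [H1 H2] [K1 K2]; apply le_antisym; auto. Qed.

Lemma lt_lub (A : W -> Prop) s x : is_lub A s -> x < s -> exists y, A y /\ x < y.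
Proof.
  intros [_ H] K; apply NNPP; intros N; apply (lt_irrefl (x := x)).
  apply (lt_le_trans K), H; intros y Ay; apply nlt_le; intros L; apply N; eauto.
Qed.

Lemma lub_limit (A : W -> Prop) s :
  is_lub A s -> (exists x, A x) -> (forall x, A x -> limit_ord x) -> limit_ord s.
Proof.
  intros Hs [x Ax] L; split.
  - destruct (L x Ax) as [[y Hy] _]; exists y; apply (lt_le_trans Hy), Hs, Ax.
  - intros y Hy; destruct (lt_lub Hs Hy) as [z [Az Hz]].
    destruct (proj2 (L z Az) y Hz) as [t [H1 H2]]; exists t; split; [exact H1 |].
    apply (lt_le_trans H2), Hs, Az.
Qed.

Lemma succ_exists k x : limit_ord k -> x < k -> exists y, is_succ x y /\ y < k.
Proof.
  intros L H; destruct (proj2 L x H) as [y [K1 K2]].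
  destruct (least (A := fun y => x < y)) as [s [H1 H2]]; [eauto |].
  exists s; split; [split; auto |]; apply (le_lt_trans (H2 y K1) K2).
Qed.

Lemma regular_bound k b (A : W -> Prop) (f : W -> W) :
  regular k -> b < k -> (forall x, A x -> x < b) -> (forall x, A x -> f x < k) ->
  exists c, c < k /\ forall x, A x -> f x < c.
Proof.
  intros R Hb HA Hf; destruct R as [L R].
  (* [regular] takes functions defined on all of [b]; outside [A] the default is [b], which is below
     [k]. *)
  destruct (R b Hb (fun x => if excluded_middle_informative (A x) then f x else b)) as [c [H1 H2]].
  - intros x _; destruct (excluded_middle_informative (A x)); auto.
  - exists c; split; [exact H1 |]; intros x Ax; specialize (H2 x (HA x Ax)).
    destruct (excluded_middle_informative (A x)); tauto.
Qed.

Lemma Fix_unfold (X : W -> Type) (F : forall x, (forall y, y < x -> X y) -> X x) (x : W) :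
  Fix (@wo_wf W) X F x = F x (fun y _ => Fix (@wo_wf W) X F y).
Proof.
  apply Fix_eq; intros y f g H; f_equal.
  apply functional_extensionality_dep; intros z.
  apply functional_extensionality_dep; intros K; apply H.
Qed.

(* The closure points are unbounded: [h x] for [x] below the limit ordinal [w]
   exceeds a [B]-bound of [h y] for every [y < x], and the supremum is closed. *)
Lemma club_closure k (B : W -> W -> Prop) :
  regular k -> (exists w, w < k /\ limit_ord w) ->
  (forall x, x < k -> exists c, c < k /\ B x c) ->
  (forall x y c, B y c -> x <= y -> B x c) ->
  club k (fun d => d < k /\ limit_ord d /\ forall x, x < d -> exists c, c < d /\ B x c).
Proof.
  intros R [w [Hw Lw]] HB Bmon; split; [| split]; [tauto | |].
  - intros a Ha.
    assert (HF : exists F : W -> W, forall x, x < k -> F x < k /\ B x (F x)).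
    { exists (fun x => epsilon (inhabits a) (fun c => c < k /\ B x c)).
      intros x Hx; apply (epsilon_spec (inhabits a) (fun c => c < k /\ B x c)); auto. }
    destruct HF as [F HF].
    set (G := fun (x : W) (rec : forall y, y < x -> W) =>
      epsilon (inhabits a) (fun z => z < k /\ a < z /\
         forall y (H : y < x), rec y H < z /\ F (rec y H) < z)).
    set (h := Fix (@wo_wf W) (fun _ => W) G).
    assert (hP : forall x, x < k -> h x < k /\ a < h x /\
              forall y, y < x -> h y < h x /\ F (h y) < h x).
    { intros x; induction (wo_wf x) as [x _ IH]; intros Hx.
      assert (E : h x = epsilon (inhabits a) (fun z => z < k /\ a < z /\
         forall y (H : y < x), h y < z /\ F (h y) < z)) by apply (Fix_unfold G).
      rewrite E; apply epsilon_spec; clear E.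
      destruct (regular_bound (k := k) (b := x) (A := fun y => y < x) (f := h)) as [c [H1 H2]]; auto.
      { intros y Hy; apply IH; [exact Hy | exact (wo_trans Hy Hx)]. }
      destruct (regular_bound (k := k) (b := x) (A := fun y => y < x) (f := fun y => F (h y)))
        as [d [H3 H4]]; auto.
      { intros y Hy; apply HF, IH; [exact Hy | exact (wo_trans Hy Hx)]. }
      assert (exists m, m < k /\ a < m /\ c <= m /\ d <= m) as [m [M1 [M2 [M3 M4]]]].
      { destruct R as [[_ L] _]; destruct (L a Ha) as [a' [A1 A2]].
        assert (exists m, m < k /\ a' <= m /\ c <= m) as [m [M1 [M2 M3]]].
        { destruct (lt_or_le a' c); [exists c | exists a']; auto. }
        destruct (lt_or_le d m) as [D | D].
        - exists m; split; [auto |]; split; [exact (lt_le_trans A1 M2) | auto].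
        - exists d; split; [auto |]; split; [exact (lt_le_trans A1 (le_trans M2 D)) |].
          split; [exact (le_trans M3 D) | auto]. }
      exists m; split; [exact M1 |]; split; [exact M2 |]; intros y Hy; split.
      - exact (lt_le_trans (H2 y Hy) M3).
      - exact (lt_le_trans (H4 y Hy) M4). }
    destruct (regular_bound (k := k) (b := w) (A := fun y => y < w) (f := h)) as [c [C1 C2]]; auto.
    { intros x Hx; apply hP; exact (wo_trans Hx Hw). }
    destruct (lub_exists (A := fun z => exists x, x < w /\ z = h x) (t := c)) as [d Hd].
    { intros z [x [Hx ->]]; left; auto. }
    assert (Hlt : forall x, x < w -> h x < d).
    { intros x Hx; destruct (proj2 Lw x Hx) as [y [H1 H2]].
      apply (lt_le_trans (y := h y)); [apply hP; auto; exact (wo_trans H2 Hw) |].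
      apply Hd; eauto. }
    assert (Hcl : forall x, x < d -> exists y, x < h y /\ y < w).
    { intros x Hx; destruct (lt_lub Hd Hx) as [z [[y [H1 ->]] H2]]; eauto. }
    exists d; split.
    + split; [apply (le_lt_trans (y := c)); auto; apply Hd; intros z [x [Hx ->]]; left; auto |].
      split.
      * split; [destruct Lw as [[x Hx] _]; exists (h x); auto |].
        intros x Hx; destruct (Hcl x Hx) as [y [H1 H2]]; exists (h y); auto.
      * intros x Hx; destruct (Hcl x Hx) as [y [H1 H2]].
        destruct (proj2 Lw y H2) as [z [H3 H4]].
        exists (F (h y)); split.
        -- apply (wo_trans (y := h z)); [apply hP; auto; exact (wo_trans H4 Hw) | auto].
        -- apply (Bmon x (h y)); [apply HF, hP; exact (wo_trans H2 Hw) | auto].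
    + destruct Lw as [[x Hx] _]; apply (wo_trans (y := h x)); auto; apply hP; exact (wo_trans Hx Hw).
  - intros d Hd Ld H; split; [exact Hd |]; split; [exact Ld |].
    intros x Hx; destruct (H x Hx) as [y [[_ [_ Hy]] [H1 H2]]].
    destruct (Hy x H1) as [c [H3 H4]]; exists c; split; [exact (wo_trans H3 H2) | exact H4].
Qed.

Lemma limits_unbounded k x :
  regular k -> (exists w, w < k /\ limit_ord w) -> x < k ->
  exists y, limit_ord y /\ x < y /\ y < k.
Proof.
  intros R Hw Hx.
  destruct (club_closure (k := k) (B := fun x c => True) R Hw) as [_ [H _]]; auto.
  - intros y Hy; exists y; auto.
  - destruct (H x Hx) as [y [H1 H2]]; exists y; tauto.
Qed.

(** * Binary sequences *)

Implicit Types e n m : bseq W.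

Lemma bseq_eq e n : lg e = lg n -> (forall x, x < lg e -> val e x = val n x) -> e = n.
Proof.
  destruct e as [a v Hv], n as [b u Hu]; simpl; intros <- H.
  assert (v = u) as <-.
  { apply functional_extensionality; intros x.
    destruct (classic (x < a)); [auto | rewrite Hv, Hu; auto]. }
  f_equal; apply proof_irrelevance.
Qed.

Lemma val_restr e b x : x < b -> val (restr e b) x = val e x.
Proof. intros H; simpl; destruct (excluded_middle_informative (x < b)); tauto. Qed.

Lemma restr_restr e b c : c <= b -> restr (restr e b) c = restr e c.
Proof.
  intros H; apply bseq_eq; [reflexivity |]; intros x Hx; simpl in Hx.
  rewrite !val_restr; auto; exact (lt_le_trans Hx H).
Qed.

Lemma restr_all e : restr e (lg e) = e.
Proof. apply bseq_eq; [reflexivity |]; intros x Hx; apply val_restr, Hx. Qed.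

Lemma restr_eq e b : lg e = b -> restr e b = e.
Proof. intros <-; apply restr_all. Qed.

Lemma prefix_refl e : prefix e e.
Proof. split; [auto | apply restr_all]. Qed.

Lemma prefix_restr e b : b <= lg e -> prefix (restr e b) e.
Proof. intros H; split; auto. Qed.

Lemma prefix_trans e n m : prefix e n -> prefix n m -> prefix e m.
Proof.
  intros [H1 H2] [K1 K2]; split; [exact (le_trans H1 K1) |].
  rewrite <- H2 at 2; rewrite <- K2, restr_restr; auto.
Qed.

Lemma prefix_val e n x : prefix e n -> x < lg e -> val n x = val e x.
Proof. intros [_ <-] H; simpl in H; rewrite val_restr; auto. Qed.

Lemma prefix_intro e n : lg e <= lg n -> (forall x, x < lg e -> val n x = val e x) -> prefix e n.
Proof.
  intros H K; split; [exact H |]; apply bseq_eq; [reflexivity |].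
  intros x Hx; simpl in Hx; rewrite val_restr; auto.
Qed.

Lemma prefix_restr_common e n b : prefix e n -> lg e <= b -> prefix e (restr n b).
Proof.
  intros H L; apply prefix_intro; [exact L |]; intros x Hx.
  rewrite val_restr; [exact (prefix_val H Hx) | exact (lt_le_trans Hx L)].
Qed.

Lemma restr_prefix e n b : prefix e n -> b <= lg e -> restr e b = restr n b.
Proof. intros [H <-] K; rewrite restr_restr; auto. Qed.

Lemma prefix_lg_eq e n : prefix e n -> lg e = lg n -> e = n.
Proof. intros [_ H] E; rewrite <- H, E; apply restr_all. Qed.

Lemma pad_exists e b : lg e <= b -> exists n, lg n = b /\ prefix e n.
Proof.
  intros H.
  assert (V : forall x, ~ x < b -> val e x = false).
  { intros x Hx; apply val_out; intros K; apply Hx; exact (lt_le_trans K H). }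
  exists (BSeq V); split; [reflexivity |]; apply prefix_intro; auto.
Qed.

Lemma snoc_exists e i b : is_succ (lg e) b -> exists n, lg n = b /\ is_snoc e i n.
Proof.
  intros H.
  set (v := fun x => if excluded_middle_informative (x = lg e) then i else val e x).
  assert (V : forall x, ~ x < b -> v x = false).
  { intros x Hx; unfold v; destruct (excluded_middle_informative (x = lg e)) as [-> | _].
    - destruct H; contradiction.
    - apply val_out; intros K; apply Hx; exact (wo_trans K (proj1 H)). }
  exists (BSeq V); split; [reflexivity |]; split; [exact H |]; split.
  - apply prefix_intro; [left; apply H |]; simpl; intros x Hx; unfold v.
    destruct (excluded_middle_informative (x = lg e)) as [-> | _]; auto.
    destruct (lt_irrefl Hx).
  - simpl; unfold v; destruct (excluded_middle_informative (lg e = lg e)); tauto.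
Qed.

(** Values are [false] outside the domain, so a value [true] in one member settles the union:
    shorter members cannot contradict it, and comparable members agree where both are defined. *)
Lemma bseq_union (J : Type) (A : J -> Prop) (b : J -> bseq W) s :
  (forall i j, A i -> A j -> prefix (b i) (b j) \/ prefix (b j) (b i)) ->
  is_lub (fun x => exists j, A j /\ x = lg (b j)) s ->
  exists c, lg c = s /\ forall j, A j -> prefix (b j) c.
Proof.
  intros H Hs.
  set (v := fun x => if excluded_middle_informative (exists j, A j /\ val (b j) x = true)
                     then true else false).
  assert (V : forall x, ~ x < s -> v x = false).
  { intros x Hx; unfold v.
    destruct (excluded_middle_informative _) as [[j [Aj E]] | _]; [| reflexivity].
    rewrite val_out in E; [discriminate |].
    intros K; apply Hx, (lt_le_trans K), Hs; eauto. }
  exists (BSeq V); split; [reflexivity |]; intros j Aj; apply prefix_intro.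
  - apply Hs; eauto.
  - simpl; intros x Hx; unfold v.
    destruct (excluded_middle_informative _) as [[i [Ai E]] | N].
    + destruct (H i j Ai Aj) as [K | K].
      * rewrite (prefix_val K); auto.
        apply NNPP; intros L; rewrite val_out in E; [discriminate | exact L].
      * rewrite <- (prefix_val K); auto.
    + destruct (val (b j) x) eqn:E; [| reflexivity]; destruct N; eauto.
Qed.

(** * Counting *)

(* [e] is coded by [e] followed by a 1 and then 0's: the length of [e] is the
   largest index with value 1. *)
Lemma short_bseq_code b :
  exists f : bseq W -> bseq W, (forall e, lg e < b -> lg (f e) = b) /\
    forall e n, lg e < b -> lg n < b -> f e = f n -> e = n.
Proof.
  set (v := fun e x => if excluded_middle_informative (x = lg e) then true else val e x).
  assert (V : forall e x, ~ x < b ->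
     (if excluded_middle_informative (x < b) then v e x else false) = false).
  { intros e x H; destruct (excluded_middle_informative (x < b)); tauto. }
  exists (fun e => BSeq (V e)); split; [reflexivity |].
  assert (K : forall e n, lg e < b -> lg n < b -> BSeq (V e) = BSeq (V n) ->
                 forall x, x < b -> v e x = v n x).
  { intros e n _ _ E x Hx; apply (f_equal (fun m => val m x)) in E; simpl in E.
    destruct (excluded_middle_informative (x < b)); tauto. }
  assert (L : forall e n, lg e < b -> lg n < b -> (forall x, x < b -> v e x = v n x) -> lg e <= lg n).
  { intros e n He Hn E; apply nlt_le; intros H; specialize (E (lg e) He); unfold v in E.
    destruct (excluded_middle_informative (lg e = lg e)); [| tauto].
    destruct (excluded_middle_informative (lg e = lg n)) as [D | D].
    - rewrite D in H; exact (lt_irrefl H).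
    - rewrite val_out in E; [discriminate |]; exact (lt_asym H). }
  intros e n He Hn E; specialize (K e n He Hn E).
  assert (D : lg e = lg n) by (apply le_antisym; apply L; auto; intros; symmetry; auto).
  apply bseq_eq; [exact D |]; intros x Hx; specialize (K x (wo_trans Hx He)); unfold v in K.
  destruct (excluded_middle_informative (x = lg e)) as [-> | _]; [destruct (lt_irrefl Hx) |].
  destruct (excluded_middle_informative (x = lg n)) as [-> | _]; [| exact K].
  rewrite D in Hx; destruct (lt_irrefl Hx).
Qed.

Lemma short_bseq_size k b : strong_limit k -> b < k -> size_lt (fun e : bseq W => lg e < b) k.
Proof.
  intros SL Hb; destruct (SL b Hb) as [c [Hc [f [f1 f2]]]].
  destruct (short_bseq_code b) as [g [g1 g2]].
  exists c; split; [exact Hc |]; exists (fun e => f (g e)); split; auto.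
Qed.

(** The sequences shorter than [b] inject into some [c < k]. The part of [T] below [b] thus becomes
    a subset of [c], hence a binary sequence of length [c], and [strong_limit] is applied once more
    at [c]. *)
Lemma tree_size k b : strong_limit k -> b < k ->
  exists c, c < k /\ exists f : (bseq W -> Prop) -> W,
    (forall T, f T < c) /\
    forall T U, f T = f U -> forall e, lg e < b -> (T e <-> U e).
Proof.
  intros SL Hb; destruct (short_bseq_size SL Hb) as [c [Hc [g [g1 g2]]]].
  set (v := fun (T : bseq W -> Prop) x =>
    if excluded_middle_informative (x < c /\ exists e, lg e < b /\ T e /\ g e = x)
    then true else false).
  assert (V : forall T x, ~ x < c -> v T x = false).
  { intros T x H; unfold v; destruct (excluded_middle_informative _); tauto. }
  destruct (SL c Hc) as [d [Hd [h [h1 h2]]]].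
  exists d; split; [exact Hd |]; exists (fun T => h (BSeq (V T))); split; [intros; auto |].
  assert (K : forall T U, h (BSeq (V T)) = h (BSeq (V U)) -> forall e, lg e < b -> T e -> U e).
  { intros T U E e He Te.
    apply h2 in E; auto; apply (f_equal (fun m => val m (g e))) in E; simpl in E; unfold v in E.
    destruct (excluded_middle_informative _) as [_ | N]; [| destruct N; split; [auto | exists e; auto]].
    destruct (excluded_middle_informative _) as [[_ [n [Hn [Un E']]]] | _]; [| discriminate].
    apply g2 in E'; auto; subst; auto. }
  intros T U E e He; split; [apply (K T U) | apply (K U T)]; auto.
Qed.

End Ordinals.

(** * Conditions *)

Section Conditions.
Context (W : wellorder) (lam : W).
Implicit Types (p q r u v w : cond lam) (e n m b : bseq W).
Local Notation "p ⪯ q" := (@cond_le W lam p q) (at level 70).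

Lemma cht_limit p : limit_ord (cht p).
Proof. apply (ctree_tree p). Qed.

Lemma ctree_lg p e : ctree p e -> lg e < cht p.
Proof. apply (ctree_tree p). Qed.

Lemma ctree_prefix p e n : ctree p e -> prefix n e -> ctree p n.
Proof. apply (ctree_tree p). Qed.

Lemma ctree_restr p e x : ctree p e -> x <= lg e -> ctree p (restr e x).
Proof. intros H K; apply (ctree_prefix H), prefix_restr, K. Qed.

Lemma ctree_ext p e x :
  ctree p e -> lg e <= x -> x < cht p -> exists n, ctree p n /\ lg n = x /\ prefix e n.
Proof. apply (ctree_tree p). Qed.

Lemma ctree_level p x : x < cht p -> exists n, ctree p n /\ lg n = x.
Proof.
  intros H; destruct (ctree_tree p) as (_ & _ & (e & He & Ee) & _).
  destruct (ctree_ext (p := p) (e := e) (x := x)) as (n & H1 & H2 & _); eauto.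
  apply nlt_le, Ee.
Qed.

Lemma cond_le_sub p q e : p ⪯ q -> ctree p e -> ctree q e.
Proof. intros H K; apply H, K. Qed.

Lemma cond_le_cht p q : p ⪯ q -> cht p <= cht q.
Proof.
  intros H; apply nlt_le; intros K; destruct (ctree_level K) as (n & H1 & H2).
  apply (lt_irrefl (x := cht q)); rewrite <- H2 at 1; apply ctree_lg, (cond_le_sub H H1).
Qed.

Lemma cond_le_refl p : p ⪯ p.
Proof. intros e; split; [intros H; split; [exact H | exact (ctree_lg H)] | tauto]. Qed.

Lemma cond_le_trans p q r : p ⪯ q -> q ⪯ r -> p ⪯ r.
Proof.
  intros H K e; split.
  - intros He; split; [exact (cond_le_sub K (cond_le_sub H He)) | exact (ctree_lg He)].
  - intros [He L]; apply H; split; [| exact L]; apply K; split; [exact He |].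
    exact (lt_le_trans L (cond_le_cht H)).
Qed.

Lemma cond_le_intro p q :
  (forall e, lg e < cht p -> (ctree p e <-> ctree q e)) -> p ⪯ q.
Proof.
  intros H e; split.
  - intros He; pose proof (ctree_lg He); split; auto; apply H; auto.
  - intros [He L]; apply H; auto.
Qed.

Lemma lim_branch_le p q x b : p ⪯ q -> x <= cht p -> lim_branch (ctree q) x b -> lim_branch (ctree p) x b.
Proof.
  intros H L [E K]; split; [exact E |]; intros y Hy; apply H; split; auto.
  exact (lt_le_trans Hy L).
Qed.

Lemma lim_branch_restr p e x : ctree p e -> x <= lg e -> lim_branch (ctree p) x (restr e x).
Proof.
  intros H L; split; [reflexivity |]; intros y Hy; rewrite restr_restr; [| auto].
  apply (ctree_restr H); left; exact (lt_le_trans Hy L).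
Qed.

Lemma lim_branch_prefix (T : bseq W -> Prop) x b n :
  lim_branch T x b -> prefix n b -> lg n < x -> T n.
Proof. intros [E H] [_ <-] K; apply H, K. Qed.

(** * Adding full levels on top of a set of branches *)

Section Plus.
Variables (u : cond lam) (h : W) (K : bseq W -> Prop).
Hypothesis h_limit : limit_ord h.
Hypothesis h_lt : h < lam.
Hypothesis h_gt : cht u < h.
Hypothesis K_dense : forall e, ctree u e ->
  exists b, lim_branch (ctree u) (cht u) b /\ K b /\ prefix e b.
Hypothesis K_omit : forall b c, lim_branch (ctree u) (cht u) b -> ~ K b ->
  lim_branch (ctree u) (cht u) c -> ~ K c -> b = c.

(** From level [cht u] on, membership depends only on the restriction to [cht u]. So a branch can
    newly be missing only at level [cht u], and above it any padding stays in the tree. *)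
Definition plus_tree e : Prop :=
  ctree u e \/ (cht u <= lg e /\ lg e < h /\
                lim_branch (ctree u) (cht u) (restr e (cht u)) /\ K (restr e (cht u))).

Lemma plus_low e : lg e < cht u -> (plus_tree e <-> ctree u e).
Proof.
  intros L; split; [| left; auto]; intros [H | [H _]]; [exact H |].
  destruct (le_nlt H L).
Qed.

Lemma plus_lg e : plus_tree e -> lg e < h.
Proof. intros [H | H]; [exact (wo_trans (ctree_lg H) h_gt) | tauto]. Qed.

Lemma plus_up e n : plus_tree e -> cht u <= lg e -> prefix e n -> lg n < h -> plus_tree n.
Proof.
  intros [H | (H1 & H2 & H3 & H4)] L P Hn; [destruct (le_nlt L (ctree_lg H)) |].
  right; rewrite <- (restr_prefix P L); split; [exact (le_trans L (proj1 P)) | auto].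
Qed.

Lemma plus_prefix e n : plus_tree e -> prefix n e -> plus_tree n.
Proof.
  intros [H | (H1 & H2 & H3 & H4)] P; [left; exact (ctree_prefix H P) |].
  destruct (lt_or_le (lg n) (cht u)) as [L | L].
  - left; apply (lim_branch_prefix H3); [| exact L].
    apply prefix_restr_common; auto.
  - right; rewrite (restr_prefix P L); split; [exact L |]; split; [| auto].
    exact (le_lt_trans (proj1 P) H2).
Qed.

Lemma plus_ext e x : plus_tree e -> lg e <= x -> x < h -> cht u <= x ->
  exists n, plus_tree n /\ lg n = x /\ prefix e n.
Proof.
  intros He L Hx Lx.
  assert (exists c, plus_tree c /\ prefix e c /\ cht u <= lg c /\ lg c <= x) as (c & C1 & C2 & C3 & C4).
  { destruct (lt_or_le (lg e) (cht u)) as [M | M]; [| exists e; auto using prefix_refl].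
    destruct (K_dense (e := e)) as (b & B1 & B2 & B3); [apply (plus_low M), He |].
    assert (Eb : lg b = cht u) by apply B1.
    exists b; split; [| rewrite Eb; auto].
    right; rewrite (restr_eq Eb), Eb; auto. }
  destruct (pad_exists C4) as (n & N1 & N2); exists n; split; [| split; auto].
  - apply (plus_up C1 C3 N2); rewrite N1; exact Hx.
  - exact (prefix_trans C2 N2).
Qed.

Lemma plus_is_tree : is_tree h plus_tree.
Proof.
  split; [exact h_limit |]; split; [exact plus_lg |]; split; [| split; [| split]].
  - destruct (ctree_tree u) as (_ & _ & (e & He & Ee) & _); exists e; split; [left |]; auto.
  - exact plus_prefix.
  - intros e i He; destruct (lt_or_le (lg e) (cht u)) as [L | L].
    + destruct (ctree_tree u) as (_ & _ & _ & _ & H & _).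
      destruct (H e i) as (n & N1 & N2); [apply (plus_low L), He |].
      exists n; split; [left |]; auto.
    + destruct (succ_exists h_limit (plus_lg He)) as (y & Y1 & Y2).
      destruct (snoc_exists i Y1) as (n & N1 & N2); exists n; split; [| exact N2].
      apply (plus_up He L); [apply N2 | rewrite N1; exact Y2].
  - intros e x He L Hx; destruct (lt_or_le x (cht u)) as [M | M]; [| apply plus_ext; auto].
    destruct (ctree_ext (p := u) (e := e) (x := x)) as (n & N1 & N2); auto.
    + apply plus_low; [exact (le_lt_trans L M) | exact He].
    + exists n; split; [left |]; auto.
Qed.

Lemma plus_height : true_height h plus_tree.
Proof.
  intros e He.
  assert (exists c, plus_tree c /\ prefix e c /\ cht u <= lg c) as (c & C1 & C2 & C3).
  { destruct (lt_or_le (lg e) (cht u)) as [M | M]; [| exists e; auto using prefix_refl].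
    destruct (plus_ext He (x := cht u)) as (n & N1 & N2 & N3); auto.
    exists n; rewrite N2; auto. }
  destruct (@pad_exists W c h) as (b & B1 & B2); [left; apply plus_lg, C1 |].
  exists b; split; [| exact (prefix_trans C2 B2)].
  split; [exact B1 |]; intros x Hx.
  destruct (lt_or_le x (lg c)) as [M | M].
  - rewrite <- (restr_prefix B2); auto; apply (plus_prefix C1), prefix_restr; auto.
  - apply (plus_up C1 C3); [apply prefix_restr_common; auto | exact Hx].
Qed.

(** Below [cht u] the rule is inherited from [u]; at [cht u] the missing branches are those outside
    [K]; above it no limit branch is missing. *)
Lemma plus_omit d : d < h -> limit_ord d ->
  forall e n, lim_branch plus_tree d e -> ~ plus_tree e ->
              lim_branch plus_tree d n -> ~ plus_tree n -> e = n.
Proof.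
  intros Hd Ld.
  assert (Low : forall e, d <= cht u -> lim_branch plus_tree d e -> lim_branch (ctree u) d e).
  { intros e L [E H]; split; [exact E |]; intros y Hy; apply plus_low; [| apply H, Hy].
    exact (lt_le_trans Hy L). }
  intros e n He Ne Hn Nn; destruct (wo_total d (cht u)) as [L | [L | L]].
  - apply (ctree_omit (c := u) L Ld); auto; intros H; [apply Ne | apply Nn]; left; exact H.
  - assert (Key : forall e, lim_branch plus_tree d e -> ~ plus_tree e ->
              lim_branch (ctree u) (cht u) e /\ ~ K e).
    { intros c Hc Nc; rewrite <- L; split; [apply Low; auto |]; intros Kc; apply Nc; right.
      assert (E : lg c = cht u) by (rewrite <- L; apply Hc).
      rewrite (restr_eq E), E; split; [auto |]; split; [auto |]; split; [| exact Kc].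
      rewrite <- L; apply Low; auto. }
    apply K_omit; apply Key; auto.
  - destruct Ne; destruct He as [E H]; pose proof (H (cht u) L) as M.
    apply (plus_up M); auto; rewrite ?E; auto; simpl; auto.
    apply prefix_restr; rewrite E; auto.
Qed.

Definition plus : cond lam := Cond h_lt plus_is_tree plus_height plus_omit.

Lemma plus_le : u ⪯ plus.
Proof.
  apply cond_le_intro; intros e L; symmetry; exact (plus_low L).
Qed.

Lemma plus_branch b : lim_branch (ctree u) (cht u) b -> (ctree plus b <-> K b).
Proof.
  intros B; assert (E : lg b = cht u) by apply B; simpl; split.
  - intros [H | (_ & _ & _ & H)].
    + apply ctree_lg in H; rewrite E in H; destruct (lt_irrefl H).
    + rewrite (restr_eq E) in H; exact H.
  - intros H; right; rewrite (restr_eq E), E; auto.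
Qed.

End Plus.

Lemma plus_exists u h (K : bseq W -> Prop) :
  limit_ord h -> h < lam -> cht u < h ->
  (forall e, ctree u e -> exists b, lim_branch (ctree u) (cht u) b /\ K b /\ prefix e b) ->
  (forall b c, lim_branch (ctree u) (cht u) b -> ~ K b ->
     lim_branch (ctree u) (cht u) c -> ~ K c -> b = c) ->
  exists p, u ⪯ p /\ cht p = h /\
    forall b, lim_branch (ctree u) (cht u) b -> (ctree p b <-> K b).
Proof.
  intros H1 H2 H3 H4 H5; exists (plus H1 H2 H3 H4 H5); split; [apply plus_le |].
  split; [reflexivity | apply plus_branch].
Qed.

Lemma plus_full_exists u h : limit_ord h -> h < lam -> cht u < h ->
  exists p, u ⪯ p /\ cht p = h /\ forall b, lim_branch (ctree u) (cht u) b -> ctree p b.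
Proof.
  intros H1 H2 H3.
  destruct (plus_exists (u := u) (h := h) (K := fun _ => True)) as (p & P1 & P2 & P3); auto.
  - intros e He; destruct (ctree_height He) as (b & B1 & B2); eauto.
  - intros b c _ N; tauto.
  - exists p; split; [auto |]; split; [auto |]; intros b B; apply (P3 b B); exact I.
Qed.

(** * Unions of chains *)

Definition is_union (A : cond lam -> Prop) u : Prop :=
  is_lub (fun x => exists p, A p /\ x = cht p) (cht u) /\
  forall e, ctree u e <-> exists p, A p /\ ctree p e.

Lemma union_le (A : cond lam -> Prop) u p :
  (forall p q, A p -> A q -> p ⪯ q \/ q ⪯ p) -> is_union A u -> A p -> p ⪯ u.
Proof.
  intros C [H1 H2] Ap; apply cond_le_intro.
  intros e L; split; [intros H; apply H2; eauto |].
  intros H; apply H2 in H; destruct H as (q & Aq & H).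
  destruct (C p q Ap Aq) as [D | D]; [apply D; auto | exact (cond_le_sub D H)].
Qed.

(** Covers the stages of the iteration at which the chain has a last member, so that no branch has
    to be built there. *)
Lemma union_max (A : cond lam -> Prop) p : A p -> (forall q, A q -> q ⪯ p) -> is_union A p.
Proof.
  intros Ap H; split.
  - split; [intros x (q & Aq & ->); exact (cond_le_cht (H q Aq)) |]; intros t K; apply K; eauto.
  - intros e; split; [eauto |]; intros (q & Aq & K); exact (cond_le_sub (H q Aq) K).
Qed.

(** Any level below [s] lies inside a member of the chain, so the tree axioms and the rule on
    omitted branches are local. True height is not local, and is therefore demanded as the last
    premise. *)
Lemma union_exists (A : cond lam -> Prop) s :
  (exists p, A p) -> (forall p q, A p -> A q -> p ⪯ q \/ q ⪯ p) ->
  is_lub (fun x => exists p, A p /\ x = cht p) s -> s < lam ->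
  (forall p e, A p -> ctree p e ->
     exists b, prefix e b /\ lim_branch (fun e => exists p, A p /\ ctree p e) s b) ->
  exists u, cht u = s /\ is_union A u.
Proof.
  intros [p0 Ap0] C Hs sl TH.
  set (T := fun e => exists p, A p /\ ctree p e).
  assert (Ls : limit_ord s).
  { apply (lub_limit Hs); [eauto |]; intros x (p & Ap & ->); apply cht_limit. }
  assert (Find : forall x, x < s -> exists p, A p /\ x < cht p).
  { intros x Hx; destruct (lt_lub Hs Hx) as (y & (p & Ap & ->) & H); eauto. }
  assert (Low : forall p e, A p -> T e -> lg e < cht p -> ctree p e).
  { intros p e Ap (q & Aq & H) L.
    destruct (C p q Ap Aq) as [D | D]; [apply D; auto | exact (cond_le_sub D H)]. }
  assert (TT : is_tree s T).
  { split; [exact Ls |]; split; [| split; [| split; [| split]]].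
    - intros e (p & Ap & H); apply (lt_le_trans (ctree_lg H)), Hs; eauto.
    - destruct (ctree_tree p0) as (_ & _ & (e & He & Ee) & _); exists e; split; [exists p0 |]; auto.
    - intros e n (p & Ap & H) P; exists p; split; [auto | exact (ctree_prefix H P)].
    - intros e i (p & Ap & H); destruct (ctree_tree p) as (_ & _ & _ & _ & K & _).
      destruct (K e i H) as (n & N1 & N2); exists n; split; [exists p |]; auto.
    - intros e x (p & Ap & H) L Hx; destruct (Find x Hx) as (q & Aq & K).
      destruct (ctree_ext (p := q) (e := e) (x := x)) as (n & N1 & N2); auto.
      + apply Low; auto; [exists p; auto | exact (le_lt_trans L K)].
      + exists n; split; [exists q |]; auto. }
  assert (TTH : true_height s T).
  { intros e (p & Ap & H); destruct (TH p e Ap H) as (b & B1 & B2); exists b; auto. }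
  assert (TO : forall d, d < s -> limit_ord d -> forall e n,
     lim_branch T d e -> ~ T e -> lim_branch T d n -> ~ T n -> e = n).
  { intros d Hd Ld e n; destruct (Find d Hd) as (p & Ap & K).
    assert (LB : forall e, lim_branch T d e -> lim_branch (ctree p) d e).
    { intros c [E H]; split; [exact E |]; intros y Hy; apply Low; auto; exact (wo_trans Hy K). }
    assert (NT : forall e, ~ T e -> ~ ctree p e) by (intros c H M; apply H; exists p; auto).
    intros; apply (ctree_omit (c := p) K Ld); auto. }
  exists (Cond sl TT TTH TO); split; [reflexivity |]; split; [exact Hs | reflexivity].
Qed.

End Conditions.

(** * Transfinite iteration *)

Section Iteration.
Context (W : wellorder) (lam : W).
Implicit Types (p q r u v w : cond lam) (e n m b : bseq W) (i j k : W).
Local Notation "p ⪯ q" := (@cond_le W lam p q) (at level 70).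

Variables (q0 : cond lam) (step : W -> cond lam -> cond lam) (bd : W)
  (Kp : cond lam -> bseq W -> Prop).
Hypothesis bd_reg : regular bd.
Hypothesis bd_le : bd <= lam.
Hypothesis q0_lt : cht q0 < bd.
Hypothesis step_le : forall i u, cht u < bd -> u ⪯ step i u.
Hypothesis step_ht : forall i u, cht u < bd -> cht (step i u) < bd.
Hypothesis step_keep : forall i u b, cht u < bd ->
  lim_branch (ctree u) (cht u) b -> Kp u b -> ctree (step i u) b.
(* Above a suitable extension of any given node all branches are kept; this is
   what makes true height survive at limits. *)
Hypothesis keep_cone : forall i (U : W -> cond lam),
  (forall j k, j <= k -> k < i -> U j ⪯ U k) ->
  forall j n, j < i -> ctree (U j) n ->
  exists j' n', j <= j' /\ j' < i /\ prefix n n' /\ ctree (U j') n' /\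
    forall k b, j' <= k -> k < i -> lim_branch (ctree (U k)) (cht (U k)) b ->
      prefix n' b -> Kp (U k) b.

(** Starting from [q0] together with all earlier results treats zero, successor and limit stages
    alike. *)
Definition it_below i (rec : forall j, j < i -> cond lam) p : Prop :=
  p = q0 \/ exists j (H : j < i), p = rec j H.

Definition it_body i (rec : forall j, j < i -> cond lam) : cond lam :=
  step i (epsilon (inhabits q0) (is_union (it_below rec))).

Definition it_p : W -> cond lam := Fix (@wo_wf W) (fun _ => cond lam) it_body.

Definition it_A i : cond lam -> Prop := it_below (fun j (_ : j < i) => it_p j).

Definition it_u i : cond lam := epsilon (inhabits q0) (is_union (it_A i)).

Lemma it_p_eq i : it_p i = step i (it_u i).
Proof. apply (Fix_unfold it_body). Qed.

Lemma it_A_q0 i : it_A i q0.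
Proof. left; reflexivity. Qed.

Lemma it_A_p i j : j < i -> it_A i (it_p j).
Proof. intros H; right; exists j, H; reflexivity. Qed.

(** [it_u i] is chosen by [epsilon] and means nothing until a union is known to exist; this is
    carried through the induction together with the bounds. At [i = bd] the height may reach
    [bd]. *)
Definition it_inv i : Prop :=
  (forall p q, it_A i p -> it_A i q -> p ⪯ q \/ q ⪯ p) /\
  (forall p, it_A i p -> q0 ⪯ p) /\
  is_union (it_A i) (it_u i) /\ (i < bd -> cht (it_u i) < bd) /\ cht (it_u i) <= bd.

Section Stage.
Variable i : W.
Hypothesis i_bd : i <= bd.
Hypothesis i_lam : i < lam.
Hypothesis IH : forall j, j < i -> it_inv j.

Lemma stage_u_lt j : j < i -> cht (it_u j) < bd.
Proof. intros H; apply (IH H); exact (lt_le_trans H i_bd). Qed.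

Lemma stage_u_p j : j < i -> it_u j ⪯ it_p j.
Proof. intros H; rewrite it_p_eq; apply step_le, stage_u_lt, H. Qed.

Lemma stage_A_u j p : j < i -> it_A j p -> p ⪯ it_u j.
Proof. intros H Ap; destruct (IH H) as (C & _ & U & _); exact (union_le C U Ap). Qed.

Lemma stage_p_u j k : j < k -> k < i -> it_p j ⪯ it_u k.
Proof. intros H K; apply stage_A_u; [exact K | apply it_A_p, H]. Qed.

Lemma stage_p_p j k : j < k -> k < i -> it_p j ⪯ it_p k.
Proof. intros H K; exact (cond_le_trans (stage_p_u H K) (stage_u_p K)). Qed.

Lemma stage_u_u j k : j <= k -> k < i -> it_u j ⪯ it_u k.
Proof.
  intros [H | ->] K; [| apply cond_le_refl].
  exact (cond_le_trans (stage_u_p (wo_trans H K)) (stage_p_u H K)).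
Qed.

Lemma stage_q0 p : it_A i p -> q0 ⪯ p.
Proof.
  intros [-> | (j & H & ->)]; [apply cond_le_refl |].
  exact (cond_le_trans (stage_A_u H (it_A_q0 j)) (stage_u_p H)).
Qed.

Lemma stage_chain p q : it_A i p -> it_A i q -> p ⪯ q \/ q ⪯ p.
Proof.
  intros Ap Aq; pose proof (stage_q0 Ap); pose proof (stage_q0 Aq).
  destruct Ap as [-> | (j & Hj & ->)]; [auto |].
  destruct Aq as [-> | (k & Hk & ->)]; [auto |].
  destruct (wo_total j k) as [L | [-> | L]]; auto using stage_p_p, cond_le_refl.
Qed.

Lemma stage_p_lt j : j < i -> cht (it_p j) < bd.
Proof. intros H; rewrite it_p_eq; apply step_ht, stage_u_lt, H. Qed.

Lemma stage_lub : exists s, is_lub (fun x => exists p, it_A i p /\ x = cht p) s /\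
  (i < bd -> s < bd) /\ s <= bd /\ s < lam.
Proof.
  assert (B : forall x, (exists p, it_A i p /\ x = cht p) -> x <= bd).
  { intros x (p & [-> | (j & H & ->)] & ->); left; auto; apply stage_p_lt, H. }
  destruct (lub_exists B) as [s Hs]; exists s; split; [exact Hs |].
  assert (s <= bd) by (apply Hs, B).
  assert (i < bd -> s < bd).
  { intros L.
    destruct (regular_bound (b := i) (A := fun j => j < i) (f := fun j => cht (it_p j)) bd_reg)
      as (c & C1 & C2); auto using stage_p_lt.
    (* [c] bounds the heights of the stages only; [q0] is also in the chain, so the larger of [c]
       and [cht q0] is taken. *)
    destruct (lt_or_le c (cht q0)) as [D | D].
    - apply (le_lt_trans (y := cht q0)); auto; apply Hs.
      intros x (p & [-> | (j & M & ->)] & ->); auto; left; exact (wo_trans (C2 j M) D).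
    - apply (le_lt_trans (y := c)); auto; apply Hs.
      intros x (p & [-> | (j & M & ->)] & ->); auto. }
  split; [auto |]; split; [auto |].
  (* For [i = bd] only [s <= bd] is available, and [i < lam] supplies the strict bound. *)
  destruct (i_bd) as [L | L]; [exact (lt_le_trans (H0 L) bd_le) |].
  rewrite <- L in H; exact (le_lt_trans H i_lam).
Qed.

(** * A coherent branch through all stages below a limit *)

Section Branch.
Variables (j0 : W) (n0 : bseq W).
Hypothesis j0_lt : j0 < i.
Hypothesis n0_in : ctree (it_u j0) n0.
Hypothesis n0_keep : forall k b, j0 <= k -> k < i ->
  lim_branch (ctree (it_u k)) (cht (it_u k)) b -> prefix n0 b -> Kp (it_u k) b.

(** A cofinal branch of stage [k] through [n0] that extends the branches chosen at all earlier
    stages from [j0] on. *)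
Definition br_spec k (rec : forall l, l < k -> bseq W) b : Prop :=
  lim_branch (ctree (it_p k)) (cht (it_p k)) b /\ prefix n0 b /\
  forall l (H : l < k), j0 <= l -> prefix (rec l H) b.

Definition br_body k (rec : forall l, l < k -> bseq W) : bseq W :=
  epsilon (inhabits n0) (br_spec rec).

Definition br : W -> bseq W := Fix (@wo_wf W) (fun _ => bseq W) br_body.

Definition br_ok k : Prop := br_spec (fun l (_ : l < k) => br l) (br k).

Lemma br_union k s : j0 < k -> k <= i -> (forall l, j0 <= l -> l < k -> br_ok l) ->
  is_lub (fun x => exists p, it_A k p /\ x = cht p) s ->
  exists c, prefix n0 c /\ (forall l, j0 <= l -> l < k -> prefix (br l) c) /\
    lim_branch (fun e => exists p, it_A k p /\ ctree p e) s c.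
Proof.
  intros Hk Ki Ok Hs.
  assert (Lg : forall l, j0 <= l -> l < k -> lg (br l) = cht (it_p l)).
  { intros l L1 L2; apply (Ok l L1 L2). }
  assert (Cof : forall p, it_A k p -> exists l, j0 <= l /\ l < k /\ cht p <= cht (it_p l)).
  { intros p [-> | (l & L & ->)].
    - exists j0; split; [auto |]; split; [auto |].
      apply cond_le_cht, stage_q0, it_A_p, j0_lt.
    - destruct (lt_or_le l j0) as [M | M]; [| eauto].
      exists j0; split; [auto |]; split; [auto |]; apply cond_le_cht, stage_p_p; auto. }
  assert (Hs' : is_lub (fun x => exists l, (j0 <= l /\ l < k) /\ x = lg (br l)) s).
  { split.
    - intros x (l & [L1 L2] & ->); rewrite Lg; auto; apply Hs; eauto using it_A_p.
    - intros t Ht; apply Hs; intros x (p & Ap & ->).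
      destruct (Cof p Ap) as (l & L1 & L2 & L3); apply (le_trans L3), Ht.
      exists l; rewrite Lg; auto. }
  destruct (bseq_union (A := fun l => j0 <= l /\ l < k) (b := br) (s := s)) as (c & C1 & C2).
  - intros l l' [L1 L2] [M1 M2]; destruct (wo_total l l') as [H | [-> | H]].
    + left; apply (Ok l' M1 M2); auto.
    + left; apply prefix_refl.
    + right; apply (Ok l L1 L2); auto.
  - exact Hs'.
  - exists c; split; [apply (prefix_trans (n := br j0)); auto; apply Ok; auto |].
    split; [auto |]; split; [exact C1 |]; intros x Hx.
    destruct (lt_lub Hs' Hx) as (y & (l & [L1 L2] & ->) & H).
    exists (it_p l); split; [apply it_A_p, L2 |].
    rewrite <- (restr_prefix (C2 l (conj L1 L2))); auto.
    apply (Ok l L1 L2); rewrite <- Lg; auto.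
Qed.

(** The union [c] of the earlier branches passes through [n0], so [n0_keep] and [step_keep] make it
    a node of [it_p k]; true height of [it_p k] then continues it to the top. *)
Lemma br_all k : j0 <= k -> k < i -> br_ok k.
Proof.
  induction (wo_wf k) as [k _ IHk]; intros K1 K2.
  assert (exists c, lim_branch (ctree (it_u k)) (cht (it_u k)) c /\ prefix n0 c /\
            forall l, j0 <= l -> l < k -> prefix (br l) c) as (c & C1 & C2 & C3).
  { destruct K1 as [K1 | <-].
    - destruct (IH K2) as (_ & _ & [U1 U2] & _).
      destruct (br_union (k := k) (s := cht (it_u k))) as (c & C1 & C2 & C3); auto.
      + intros l L1 L2; apply IHk; auto; exact (wo_trans L2 K2).
      + exists c; split; [| auto]; destruct C3 as [E H]; split; [exact E |].
        intros x Hx; apply U2, H, Hx.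
    (* At [k = j0] nothing has been chosen yet, and true height of [it_u j0] starts the
       construction. *)
    - destruct (ctree_height n0_in) as (c & C1 & C2); exists c; split; [auto |]; split; [auto |].
      intros l L1 L2; destruct (le_nlt L1 L2). }
  assert (Hc : ctree (it_p k) c).
  { rewrite it_p_eq; apply step_keep; auto using stage_u_lt. }
  destruct (ctree_height Hc) as (b & B1 & B2).
  unfold br_ok.
  replace (br k) with (epsilon (inhabits n0) (br_spec (fun l (_ : l < k) => br l)))
    by (symmetry; apply (Fix_unfold br_body)).
  apply (epsilon_spec (inhabits n0) (br_spec (fun l (_ : l < k) => br l))).
  exists b; split; [exact B1 |]; split; [exact (prefix_trans C2 B2) |].
  intros l L1 L2; apply (prefix_trans (n := c)); auto.
Qed.

End Branch.

Lemma stage_inv : it_inv i.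
Proof.
  split; [exact stage_chain |]; split; [exact stage_q0 |].
  destruct stage_lub as (s & Hs & S1 & S2 & S3).
  assert (U : is_union (it_A i) (it_u i)).
  { apply (epsilon_spec (inhabits q0) (is_union (it_A i))).
    destruct (classic (exists p, it_A i p /\ forall q, it_A i q -> q ⪯ p)) as [(p & P1 & P2) | N].
    { exists p; apply union_max; auto. }
    (* [keep_cone] speaks of the unions [it_u j], so a node of any member must first be placed in
       one of them. A member below no [it_u j] would be the maximum of the chain. *)
    assert (Up : forall p, it_A i p -> exists j, j < i /\ p ⪯ it_u j).
    { intros p Ap; apply NNPP; intros M; apply N; exists p; split; [exact Ap |].
      intros q Aq; apply NNPP; intros Nq; apply M.
      destruct Aq as [-> | (j & Hj & ->)]; [destruct Nq; apply stage_q0, Ap |].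
      exists j; split; [exact Hj |].
      destruct Ap as [-> | (k & Hk & ->)]; [apply stage_A_u; auto using it_A_q0 |].
      destruct (wo_total k j) as [L | [-> | L]]; [apply stage_p_u; auto | |]; destruct Nq;
        auto using stage_p_p, cond_le_refl. }
    destruct (union_exists (A := it_A i) (s := s)) as (u & _ & Hu); eauto using it_A_q0, stage_chain.
    intros p e Ap He; destruct (Up p Ap) as (j & Hj & Pj).
    destruct (keep_cone (i := i) (U := it_u) stage_u_u Hj (cond_le_sub Pj He))
      as (j0 & n0 & J1 & J2 & N1 & N2 & N3).
    destruct (br_union (n0 := n0) J2 (k := i) (s := s)) as (c & C1 & _ & C3); auto.
    - intros l L1 L2; apply br_all; auto.
    - exists c; split; [exact (prefix_trans N1 C1) | exact C3]. }
  split; [exact U |]; rewrite (lub_unique (proj1 U) Hs); auto.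
Qed.

End Stage.

Lemma it_inv_all i : i <= bd -> i < lam -> it_inv i.
Proof.
  induction (wo_wf i) as [i _ IH]; intros H1 H2; apply stage_inv; auto.
  intros j Hj; apply IH; [exact Hj | left; exact (lt_le_trans Hj H1) | exact (wo_trans Hj H2)].
Qed.

(** The last clause gives the exact height of each union; it is what later identifies height and
    index at closure points. *)
Lemma iteration_exists : exists u p : W -> cond lam,
  (forall i, i < bd -> cht (u i) < bd /\ p i = step i (u i)) /\
  forall i, i <= bd -> i < lam ->
    q0 ⪯ u i /\ cht (u i) <= bd /\ (forall j, j < i -> p j ⪯ u i) /\
    (forall e, ctree (u i) e -> ctree q0 e \/ exists j, j < i /\ ctree (p j) e) /\
    is_lub (fun x => x = cht q0 \/ exists j, j < i /\ x = cht (p j)) (cht (u i)).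
Proof.
  exists it_u, it_p; split.
  - intros i Hi; split; [| apply it_p_eq].
    apply it_inv_all; auto; exact (lt_le_trans Hi bd_le).
  - intros i H1 H2; destruct (it_inv_all H1 H2) as (C & Q & U & _ & B).
    split; [exact (union_le C U (it_A_q0 i)) |]; split; [exact B |]; split.
    { intros j Hj; exact (union_le C U (it_A_p Hj)). }
    split.
    + intros e He; apply U in He; destruct He as (p & [-> | (j & Hj & ->)] & He); eauto.
    + destruct U as [[U1 U2] _]; split.
      * intros x [-> | (j & Hj & ->)]; apply U1; eauto using it_A_q0, it_A_p.
      * intros t Ht; apply U2; intros x (p & [-> | (j & Hj & ->)] & ->); eauto.
Qed.

End Iteration.

(** * Sealing an antichain *)

Section Sealing.
Context (W : wellorder) (lam : W).
Implicit Types (p q r u v w : cond lam) (e n m b : bseq W) (i j k : W).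
Local Notation "p ⪯ q" := (@cond_le W lam p q) (at level 70).

(* [AA p e] stands for "p forces e into the antichain". *)
Variable AA : cond lam -> bseq W -> Prop.
Hypothesis AA_mon : forall p q e, p ⪯ q -> AA p e -> AA q e.
Hypothesis AA_anti : forall p e n, AA p e -> AA p n -> prefix e n -> e = n.
Hypothesis AA_in : forall p e, AA p e -> exists r, p ⪯ r /\ ctree r e.
Hypothesis lam_inacc : strongly_inaccessible lam.

(** Either alternative prevents stronger conditions from putting a proper extension of [n] into the
    antichain: the first through [AA_anti], the second outright. *)
Definition Dec u n : Prop :=
  (exists m, prefix m n /\ AA u m) \/ (forall r e, u ⪯ r -> prefix n e -> ~ AA r e).

Lemma Dec_mon u v n : u ⪯ v -> Dec u n -> Dec v n.
Proof.
  intros H [(m & M1 & M2) | K]; [left; eauto |].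
  right; intros r e R; apply K; exact (cond_le_trans H R).
Qed.

(** If some extension [e] of [n] can be forced into the antichain, [AA_in] also puts it into the
    tree, and [e] is decided by itself. Otherwise [n] is decided already. *)
Lemma Dec_dense u n : ctree u n -> exists r e, u ⪯ r /\ prefix n e /\ ctree r e /\ Dec r e.
Proof.
  intros Hn; destruct (classic (exists r e, u ⪯ r /\ prefix n e /\ AA r e)) as [(r & e & R & P & H) | N].
  - destruct (AA_in H) as (r' & R' & He); exists r', e; split; [exact (cond_le_trans R R') |].
    split; [exact P |]; split; [exact He |]; left; exists e; split; [apply prefix_refl |].
    exact (AA_mon R' H).
  - exists u, n; split; [apply cond_le_refl |]; split; [apply prefix_refl |]; split; [exact Hn |].
    right; intros r e R P H; apply N; eauto.
Qed.

Definition decides v w : Prop :=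
  forall n, ctree v n -> exists e, prefix n e /\ ctree w e /\ Dec w e.

(** The nodes of [v] are coded below some [c < lam], and stage [k] treats the node with code [k].
    Each step first adds a full level, so every branch is kept and limits cause no difficulty. *)
Lemma decides_exists v : exists w, v ⪯ w /\ decides v w.
Proof.
  destruct lam_inacc as (Lw & Reg & SL).
  destruct (short_bseq_size SL (cht_lt v)) as (c & Hc & f & f1 & f2).
  set (P := fun k u p => u ⪯ p /\ (forall b, lim_branch (ctree u) (cht u) b -> ctree p b) /\
    forall n, f n = k -> ctree v n -> ctree u n -> exists e, prefix n e /\ ctree p e /\ Dec p e).
  assert (PE : forall k u, exists p, P k u p).
  { intros k u.
    destruct (limits_unbounded Reg Lw (cht_lt u)) as (h & H1 & H2 & H3).
    destruct (plus_full_exists H1 H3 H2) as (p & P1 & P2 & P3).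
    destruct (classic (exists n, f n = k /\ ctree v n /\ ctree u n)) as [(n & N1 & N2 & N3) | N].
    - destruct (Dec_dense (cond_le_sub P1 N3)) as (r & e & R & E1 & E2 & E3).
      exists r; split; [exact (cond_le_trans P1 R) |]; split.
      + intros b B; exact (cond_le_sub R (P3 b B)).
      + intros n' N1' N2' _; replace n' with n; [eauto |].
        apply f2; auto using ctree_lg; congruence.
    - exists p; split; [auto |]; split; [auto |]; intros n N1 N2 N3; destruct N; eauto. }
  set (step := fun k u => epsilon (inhabits v) (P k u)).
  assert (stepP : forall k u, P k u (step k u)) by (intros k u; apply epsilon_spec, PE).
  destruct (@iteration_exists W lam v step lam (fun _ _ => True)) as (u & p & H1 & H2); auto.
  - apply cht_lt.
  - intros i u _; apply stepP.
  - intros i u _; apply cht_lt.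
  - intros i u b _ B _; apply stepP, B.
  - intros i U _ j n Hj Hn; exists j, n; auto 10 using prefix_refl.
  - destruct (H2 c) as (Q & _ & Pu & _); auto.
    exists (u c); split; [exact Q |]; intros n Hn.
    assert (Hk : f n < c) by (apply f1, ctree_lg, Hn).
    destruct (H1 (f n)) as [_ E]; [exact (wo_trans Hk Hc) |].
    destruct (H2 (f n)) as (Q' & _); [left; exact (wo_trans Hk Hc) | exact (wo_trans Hk Hc) |].
    destruct (stepP (f n) (u (f n))) as (_ & _ & S).
    destruct (S n eq_refl Hn (cond_le_sub Q' Hn)) as (e & E1 & E2 & E3); rewrite <- E in E2, E3.
    exists e; split; [exact E1 |]; split; [exact (cond_le_sub (Pu _ Hk) E2) |].
    exact (Dec_mon (Pu _ Hk) E3).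
Qed.

Definition ht_bound x c : Prop :=
  forall v, cht v <= x -> exists w, v ⪯ w /\ decides v w /\ cht w < c.

(* There are fewer than [lam] conditions of height at most [x]. *)
Lemma ht_bound_exists x : x < lam -> exists c, c < lam /\ ht_bound x c.
Proof.
  intros Hx; destruct lam_inacc as (Lw & Reg & SL).
  destruct (proj2 (proj1 Reg) x Hx) as (y & Y1 & Y2).
  destruct (tree_size SL Y2) as (c0 & C0 & f & f1 & f2).
  set (P := fun z h => h < lam /\ forall v, cht v <= x -> f (ctree v) = z ->
              exists w, v ⪯ w /\ decides v w /\ cht w = h).
  assert (PE : forall z, exists h, P z h).
  { intros z; destruct (classic (exists v, cht v <= x /\ f (ctree v) = z)) as [(v & V1 & V2) | N].
    - destruct (decides_exists v) as (w & W1 & W2).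
      exists (cht w); split; [apply cht_lt |]; intros v' V1' V2'; exists w.
      (* Conditions with the same code have the same tree, so the [w] found for [v] also serves
         [v']. *)
      assert (E : forall e, ctree v' e <-> ctree v e).
      { intros e; split; intros H.
        - apply (f2 (ctree v') (ctree v)); auto; [congruence |].
          exact (lt_le_trans (ctree_lg H) (le_trans V1' (or_introl Y1))).
        - apply (f2 (ctree v') (ctree v)); auto; [congruence |].
          exact (lt_le_trans (ctree_lg H) (le_trans V1 (or_introl Y1))). }
      split; [| split; [| reflexivity]].
      + apply (cond_le_trans (q := v)); [| exact W1].
        intros e; split; [intros H; split; [apply E, H | exact (ctree_lg H)] |].
        intros [H _]; apply E, H.
      + intros n Hn; apply W2, E, Hn.
    (* A code that belongs to no condition of height at most [x] gets the default [x]. *)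
    - exists x; split; [exact Hx |]; intros v V1 V2; destruct N; eauto. }
  set (g := fun z => epsilon (inhabits x) (P z)).
  assert (gP : forall z, P z (g z)) by (intros z; apply epsilon_spec, PE).
  destruct (regular_bound (k := lam) (b := c0) (A := fun z => z < c0) (f := g)) as (c & C1 & C2);
    auto; [intros z _; apply gP |].
  exists c; split; [exact C1 |]; intros v Hv.
  destruct (proj2 (gP (f (ctree v))) v Hv eq_refl) as (w & W1 & W2 & W3).
  exists w; split; [exact W1 |]; split; [exact W2 |]; rewrite W3; apply C2, f1.
Qed.

(** * Sealing at a closure point with the diamond *)

Section AtMu.
Variables (p0 : cond lam) (mu : W) (nu : W -> bseq W) (S0 : W -> Prop).
Hypothesis mu_lt : mu < lam.
Hypothesis mu_inacc : strongly_inaccessible mu.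
Hypothesis p0_lt : cht p0 < mu.
Hypothesis mu_closed : forall x, x < mu -> exists c, c < mu /\ ht_bound x c.
Hypothesis nu_guess : forall e, lg e = mu -> stationary mu (fun d => S0 d /\ restr e d = nu d).

(** The clause [decides u u] forbids any omission until decided nodes are dense in [u] itself;
    otherwise omitting a branch could destroy true height. *)
Definition kept u b : Prop :=
  ~ (decides u u /\ b = nu (cht u) /\ ~ exists n, prefix n b /\ lg n < cht u /\ Dec u n).

Lemma kept_dense u e : ctree u e ->
  exists b, lim_branch (ctree u) (cht u) b /\ kept u b /\ prefix e b.
Proof.
  intros He; destruct (classic (decides u u)) as [D | D].
  - destruct (D e He) as (n & N1 & N2 & N3); destruct (ctree_height N2) as (b & B1 & B2).
    exists b; split; [exact B1 |]; split; [| exact (prefix_trans N1 B2)].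
    intros (_ & _ & H); apply H; exists n; auto using ctree_lg.
  - destruct (ctree_height He) as (b & B1 & B2).
    exists b; split; [exact B1 |]; split; [| exact B2]; intros (H & _); auto.
Qed.

(** [decides u p] only promises decided nodes in the next stage; at a limit of the iteration these
    promises add up to [decides u u]. *)
Definition main_step u p : Prop :=
  u ⪯ p /\ cht u < cht p /\ cht p < mu /\ decides u p /\
  forall b, lim_branch (ctree u) (cht u) b -> (ctree p b <-> kept u b).

Lemma main_step_exists u : cht u < mu -> exists p, main_step u p.
Proof.
  intros Hu; destruct mu_inacc as (Lw & Reg & _).
  destruct (limits_unbounded Reg Lw Hu) as (h & H1 & H2 & H3).
  destruct (plus_exists (K := kept u) H1 (wo_trans H3 mu_lt) H2) as (p & P1 & P2 & P3).
  - exact (@kept_dense u).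
  (* A branch that is not kept equals [nu (cht u)], so there is at most one. *)
  - intros b c _ Nb _ Nc; apply NNPP in Nb; apply NNPP in Nc.
    destruct Nb as (_ & -> & _), Nc as (_ & -> & _); reflexivity.
  (* Closure is applied to the height [h] of [p]. Passing from [p] to [w] leaves level [cht u]
     unchanged because [cht u < h]. *)
  - destruct (mu_closed H3) as (c & C1 & C2).
    destruct (C2 p) as (w & W1 & W2 & W3); [auto |].
    pose proof (cond_le_cht W1) as Hw; rewrite P2 in Hw.
    exists w; split; [exact (cond_le_trans P1 W1) |].
    split; [exact (lt_le_trans H2 Hw) |]; split; [exact (wo_trans W3 C1) |].
    split; [intros n Hn; exact (W2 n (cond_le_sub P1 Hn)) |].
    intros b B; rewrite <- (P3 b B); split; [| exact (cond_le_sub W1)].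
    intros H; apply W1; split; [exact H |]; rewrite P2; destruct B as [-> _]; exact H2.
Qed.

(** If some stage from [j] on decides itself, it has a decided node above [n]; the node stays
    decided, so every later branch through it is kept. If no such stage exists, nothing is omitted
    from [j] on. *)
Lemma kept_cone i (U : W -> cond lam) :
  (forall j k, j <= k -> k < i -> U j ⪯ U k) ->
  forall j n, j < i -> ctree (U j) n ->
  exists j' n', j <= j' /\ j' < i /\ prefix n n' /\ ctree (U j') n' /\
    forall k b, j' <= k -> k < i -> lim_branch (ctree (U k)) (cht (U k)) b ->
      prefix n' b -> kept (U k) b.
Proof.
  intros M j n Hj Hn.
  destruct (classic (exists k, j <= k /\ k < i /\ decides (U k) (U k))) as [(k & K1 & K2 & D) | N].
  - destruct (D n (cond_le_sub (M j k K1 K2) Hn)) as (e & E1 & E2 & E3).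
    exists k, e; split; [exact K1 |]; split; [exact K2 |]; split; [exact E1 |]; split; [exact E2 |].
    intros l b L1 L2 _ P (_ & _ & F); apply F; exists e; split; [exact P |]; split.
    + exact (ctree_lg (cond_le_sub (M k l L1 L2) E2)).
    + exact (Dec_mon (M k l L1 L2) E3).
  - exists j, n; split; [auto |]; split; [auto |]; split; [apply prefix_refl |]; split; [auto |].
    intros k b K1 K2 _ _ (D & _); apply N; eauto.
Qed.

(* Were a branch [b] of the limit tree undecided, the diamond would guess it at
   a closure point [d] of the iteration, where it would have been omitted. *)
Lemma sealed_at : exists w, p0 ⪯ w /\ cht w = mu /\
  forall b, lim_branch (ctree w) mu b -> exists n, prefix n b /\ lg n < mu /\ Dec w n.
Proof.
  destruct mu_inacc as (Lw & Reg & _).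
  set (step := fun (_ : W) u => epsilon (inhabits p0) (main_step u)).
  assert (stepP : forall i u, cht u < mu -> main_step u (step i u)).
  { intros i u Hu; apply epsilon_spec, main_step_exists, Hu. }
  destruct (@iteration_exists W lam p0 step mu kept) as (u & p & H1 & H2); auto.
  { intros i u Hu; apply (stepP i u Hu). }
  { intros i u Hu; apply (stepP i u Hu). }
  { intros i u b Hu B; apply (stepP i u Hu), B. }
  { exact kept_cone. }
  assert (pP : forall i, i < mu -> main_step (u i) (p i)).
  { intros i Hi; destruct (H1 i Hi) as [Hu ->]; apply stepP, Hu. }
  assert (pu : forall i j, i < j -> j <= mu -> p i ⪯ u j).
  { intros i j L M; apply H2; auto; exact (le_lt_trans M mu_lt). }
  assert (uu : forall i j, i < j -> j <= mu -> u i ⪯ u j /\ cht (u i) < cht (u j)).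
  { intros i j L M; pose proof (pu i j L M) as PU; destruct (pP i) as (A1 & A2 & _).
    - exact (lt_le_trans L M).
    - split; [exact (cond_le_trans A1 PU) | exact (lt_le_trans A2 (cond_le_cht PU))]. }
  assert (ge : forall i, i <= mu -> i <= cht (u i)).
  { intros i; induction (wo_wf i) as [i _ IH]; intros Hi; apply nlt_le; intros L.
    assert (Hj : cht (u i) <= mu) by (left; exact (lt_le_trans L Hi)).
    exact (le_nlt (IH _ L Hj) (proj2 (uu _ _ L Hi))). }
  destruct (H2 mu) as (Q & B & _); auto.
  assert (E : cht (u mu) = mu) by (apply le_antisym; auto).
  exists (u mu); split; [exact Q |]; split; [exact E |].
  intros b Hb; apply NNPP; intros N.
  assert (C : club mu (fun d => d < mu /\ limit_ord d /\ forall x, x < d -> exists c, c < d /\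
                (forall y, y <= x -> cht (u y) < c))).
  { apply (club_closure (B := fun x c => forall y, y <= x -> cht (u y) < c) Reg Lw).
    - intros x Hx; destruct (H1 x Hx) as [Hu _].
      destruct (proj2 (proj1 Reg) _ Hu) as (c & C1 & C2); exists c; split; [exact C2 |].
      intros y [Hy | ->]; [| exact C1].
      exact (wo_trans (proj2 (uu y x Hy (or_introl Hx))) C1).
    - intros x y c H L z Hz; exact (H z (le_trans Hz L)). }
  destruct (nu_guess (proj1 Hb) C) as (d & Hd & [_ Gd] & _ & Ld & Cd).
  (* Height and index agree here, so the guess [nu d] concerns exactly the level that step [d] may
     thin out. *)
  assert (Ed : cht (u d) = d).
  { apply le_antisym; [| apply ge; auto].
    destruct (H2 d) as (_ & _ & _ & _ & [_ L]); [auto | exact (wo_trans Hd mu_lt) |].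
    apply L; intros x [-> | (j & Hj & ->)].
    - destruct Ld as [[z Hz] _]; destruct (Cd z Hz) as (c & C1 & C2).
      destruct (H2 z) as (Qz & _); [left; exact (wo_trans Hz Hd) | exact (wo_trans Hz (wo_trans Hd mu_lt)) |].
      left; apply (le_lt_trans (cond_le_cht Qz)); exact (wo_trans (C2 z (or_intror eq_refl)) C1).
    - destruct (proj2 Ld j Hj) as (k & K1 & K2); destruct (Cd k K2) as (c & C1 & C2).
      left; apply (le_lt_trans (cond_le_cht (pu j k K1 (or_introl (wo_trans K2 Hd))))).
      exact (wo_trans (C2 k (or_intror eq_refl)) C1). }
  (* As [d] is a limit, each node of [u d] lies in some [u k] with [k < d], and step [k] placed a
     decided node above it. *)
  assert (Dd : decides (u d) (u d)).
  { intros n Hn.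
    assert (exists k, k < d /\ ctree (u k) n) as (k & K1 & K2).
    { destruct (H2 d) as (_ & _ & _ & F & _); [auto | exact (wo_trans Hd mu_lt) |].
      destruct (F n Hn) as [Hq | (j & Hj & Hp)].
      - destruct Ld as [[z Hz] _]; exists z; split; [exact Hz |].
        destruct (H2 z) as (Qz & _); [left; exact (wo_trans Hz Hd) | exact (wo_trans Hz (wo_trans Hd mu_lt)) |].
        exact (cond_le_sub Qz Hq).
      - destruct (proj2 Ld j Hj) as (k & K1 & K2); exists k; split; [exact K2 |].
        exact (cond_le_sub (pu j k K1 (or_introl (wo_trans K2 Hd))) Hp). }
    destruct (pP k (wo_trans K1 Hd)) as (_ & _ & _ & D & _).
    destruct (D n K2) as (e & E1 & E2 & E3).
    pose proof (pu k d K1 (or_introl Hd)) as PU.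
    exists e; split; [exact E1 |]; split; [exact (cond_le_sub PU E2) | exact (Dec_mon PU E3)]. }
  destruct (uu d mu Hd) as [Ud _]; [auto |].
  assert (Bd : lim_branch (ctree (u d)) (cht (u d)) (restr b d)).
  { rewrite Ed; split; [reflexivity |]; intros y Hy; rewrite restr_restr by auto.
    apply Ud; split; [apply Hb; exact (wo_trans Hy Hd) | simpl; rewrite Ed; exact Hy]. }
  destruct (pP d Hd) as (_ & L & _ & _ & K).
  (* The final tree agrees with [p d] below [cht (p d)], which exceeds [d]; so this restriction of
     [b] survived step [d] and must be [kept]. *)
  assert (Hp : ctree (p d) (restr b d)).
  { apply (pu d mu Hd); [auto |]; split; [apply Hb, Hd |]; simpl; rewrite <- Ed at 1; exact L. }
  apply (K _ Bd) in Hp; apply Hp; split; [exact Dd |]; split; [rewrite Ed; exact Gd |].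
  intros (n & N1 & N2 & N3); apply N; exists n; split.
  - apply (prefix_trans N1), prefix_restr; left; rewrite (proj1 Hb); exact Hd.
  - split; [rewrite Ed in N2; exact (wo_trans N2 Hd) | exact (Dec_mon Ud N3)].
Qed.

End AtMu.

Lemma antichain_sealed (S S0 : W -> Prop) :
  (forall mu, S mu -> mu < lam /\ strongly_inaccessible mu) -> stationary lam S ->
  (forall mu, S mu -> diamond mu (fun d => S0 d /\ d < mu)) ->
  forall p, exists w, p ⪯ w /\ forall r e, w ⪯ r -> AA r e -> ctree w e.
Proof.
  intros HS SS SD p0; destruct lam_inacc as (Lw & Reg & SL).
  assert (C : club lam (fun d => d < lam /\ limit_ord d /\ forall x, x < d ->
                exists c, c < d /\ (ht_bound x c /\ cht p0 < c))).
  { apply (club_closure (B := fun x c => ht_bound x c /\ cht p0 < c) Reg Lw).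
    - intros x Hx; destruct (ht_bound_exists Hx) as (c & C1 & C2).
      destruct (lt_or_le (cht p0) c) as [L | L]; [eauto |].
      destruct (proj2 (proj1 Reg) _ (cht_lt p0)) as (d & D1 & D2).
      exists d; split; [exact D2 |]; split; [| exact D1]; intros v Hv.
      destruct (C2 v Hv) as (w & W1 & W2 & W3); exists w; split; [auto |]; split; [auto |].
      exact (lt_le_trans W3 (le_trans L (or_introl D1))).
    - intros x y c [H K] L; split; [| exact K]; intros v Hv; apply H; exact (le_trans Hv L). }
  destruct (SS _ C) as (mu & Hmu & Smu & _ & Lmu & Cmu).
  destruct (HS mu Smu) as [_ Imu]; destruct (SD mu Smu) as (nu & _ & G).
  destruct (@sealed_at p0 mu nu (fun d => S0 d /\ d < mu)) as (w & W1 & W2 & W3); auto.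
  - destruct Lmu as [[x Hx] _]; destruct (Cmu x Hx) as (c & C1 & _ & C2); exact (wo_trans C2 C1).
  - intros x Hx; destruct (Cmu x Hx) as (c & C1 & C2 & _); eauto.
  - exists w; split; [exact W1 |]; intros r e R H.
    (* [AA r e] does not yet put [e] into the tree of [r]; in [r'] the restriction of [e] to [mu]
       becomes a branch of [w]. *)
    destruct (AA_in H) as (r' & R' & He); pose proof (AA_mon R' H) as H'.
    pose proof (cond_le_trans R R') as R''.
    destruct (lt_or_le (lg e) (cht w)) as [L | L]; [apply R''; auto |].
    exfalso; rewrite W2 in L.
    destruct (W3 (restr e mu)) as (n & N1 & N2 & N3).
    + apply (lim_branch_le R''); [auto | apply lim_branch_restr; auto].
    + assert (P : prefix n e) by (apply (prefix_trans N1), prefix_restr, L).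
      destruct N3 as [(m & M1 & M2) | F]; [| exact (F r' e R'' P H')].
      assert (m = e) as ->.
      { apply (AA_anti (AA_mon R'' M2) H'); exact (prefix_trans M1 P). }
      exact (le_nlt (le_trans L (proj1 M1)) N2).
Qed.

End Sealing.

(** * The forcing relation *)

Section Calculus.
Context (P : Type) (le : P -> P -> Prop).
Hypothesis le_refl : forall p, le p p.
Hypothesis le_tr : forall p q r, le p q -> le q r -> le p r.
Implicit Types (p q r : P) (s t x y z a b c d : name P) (f g : fm (name P)).
Local Notation "p ⊩ f" := (forces le p f%fm) (at level 75).
Local Notation "p ≼ q" := (le p q) (at level 70).
Local Open Scope fm_scope.

Lemma eq_mono a b p q : p ≼ q -> forces_eq le a b p -> forces_eq le a b q.
Proof.
  destruct a as [I na ca], b as [J nb cb]; intros H [H1 H2]; split.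
  - intros i r R; apply H1; eauto.
  - intros j r R; apply H2; eauto.
Qed.

Lemma mem_mono s b p q : p ≼ q -> forces_mem le s b p -> forces_mem le s b q.
Proof. destruct b as [J nb cb]; intros H K r R; apply K; eauto. Qed.

Lemma forces_mono f p q : p ≼ q -> p ⊩ f -> q ⊩ f.
Proof.
  revert p q; induction f as [x y | x y | f IH | f IHf g IHg | F IH]; simpl; intros p q L K;
    eauto using eq_mono, mem_mono.
  destruct K; eauto.
Qed.

(** A formula forced densely above [p] is forced by [p]. The elimination rules below rest on this:
    to prove a forced goal one may pass to any stronger condition that supplies a witness. *)
Lemma forces_local f p : (forall q, p ≼ q -> exists r, q ≼ r /\ r ⊩ f) -> p ⊩ f.
Proof.
  revert p; induction f as [x y | x y | f IH | f IHf g IHg | f IH]; simpl; intros p H.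
  - destruct y as [J nb cb]; intros q Q; destruct (H q Q) as (r & R & K).
    destruct (K r (le_refl r)) as (r' & R' & K'); eauto.
  - destruct x as [I na ca], y as [J nb cb]; split.
    + intros i q Q C q' Q'; destruct (H q') as (r & R & [K _]); [eauto |].
      destruct (K i r (le_refl r)) with (q' := r) as (r' & R' & K'); eauto 6.
    + intros j q Q C q' Q'; destruct (H q') as (r & R & [_ K]); [eauto |].
      destruct (K j r (le_refl r)) with (q' := r) as (r' & R' & K'); eauto 6.
  - intros q Q K; destruct (H q Q) as (r & R & L); apply (L r (le_refl r)).
    exact (forces_mono R K).
  - split; [apply IHf | apply IHg]; intros q Q; destruct (H q Q) as (r & R & K1 & K2); eauto.
  - intros x; apply IH; intros q Q; destruct (H q Q) as (r & R & K); eauto.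
Qed.

Lemma forces_imp f g p : p ⊩ FImp f g <-> forall q, p ≼ q -> q ⊩ f -> q ⊩ g.
Proof.
  simpl; split.
  - intros H q Q Hf; apply forces_local; intros r R; apply NNPP; intros N.
    apply (H r); [eauto |]; split; [exact (forces_mono R Hf) |]; intros r' R' K; apply N; eauto.
  - intros H q Q [Hf Hg]; apply (Hg q (le_refl q)); auto.
Qed.

(** The witness may depend on the stronger condition; witnesses are never amalgamated into one
    name. *)
Lemma forces_ex (F : name P -> fm (name P)) p :
  p ⊩ FEx F <-> forall q, p ≼ q -> exists r, q ≼ r /\ exists x, r ⊩ F x.
Proof.
  simpl; split.
  - intros H q Q; apply NNPP; intros N; apply (H q Q); intros x r R K; apply N; eauto.
  - intros H q Q K; destruct (H q Q) as (r & R & x & L); exact (K x r R L).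
Qed.

Lemma forces_or f g p :
  p ⊩ FOr f g <-> forall q, p ≼ q -> exists r, q ≼ r /\ (r ⊩ f \/ r ⊩ g).
Proof.
  simpl; split.
  - intros H q Q; apply NNPP; intros N; apply (H q Q); split; intros r R K; apply N; eauto.
  - intros H q Q [K1 K2]; destruct (H q Q) as (r & R & [L | L]); [exact (K1 r R L) | exact (K2 r R L)].
Qed.

Lemma forces_iff f g p : p ⊩ FIff f g <-> forall q, p ≼ q -> (q ⊩ f <-> q ⊩ g).
Proof.
  unfold FIff; split.
  - intros [H1 H2] q Q; rewrite forces_imp in H1, H2; split; auto.
  - intros H; split; apply forces_imp; intros q Q; apply H, Q.
Qed.

Lemma ex_intro' (F : name P -> fm (name P)) x p : p ⊩ F x -> p ⊩ FEx F.
Proof. intros H; apply forces_ex; intros q Q; exists q; split; [auto |]; exists x; exact (forces_mono Q H). Qed.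

Lemma ex_elim (F : name P -> fm (name P)) g p :
  p ⊩ FEx F -> (forall q x, p ≼ q -> q ⊩ F x -> q ⊩ g) -> p ⊩ g.
Proof.
  intros H K; apply forces_local; intros q Q; rewrite forces_ex in H.
  destruct (H q Q) as (r & R & x & L); exists r; split; [exact R |]; eauto.
Qed.

Lemma or_introl' f g p : p ⊩ f -> p ⊩ FOr f g.
Proof. intros H; apply forces_or; intros q Q; exists q; split; [auto |]; left; exact (forces_mono Q H). Qed.

Lemma or_intror' f g p : p ⊩ g -> p ⊩ FOr f g.
Proof. intros H; apply forces_or; intros q Q; exists q; split; [auto |]; right; exact (forces_mono Q H). Qed.

Lemma or_elim f g h p :
  p ⊩ FOr f g -> (forall q, p ≼ q -> q ⊩ f -> q ⊩ h) -> (forall q, p ≼ q -> q ⊩ g -> q ⊩ h) ->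
  p ⊩ h.
Proof.
  intros H K L; apply forces_local; intros q Q; rewrite forces_or in H.
  destruct (H q Q) as (r & R & [M | M]); exists r; split; eauto.
Qed.

Lemma all_in (F : name P -> fm (name P)) a p :
  p ⊩ FAll (fun x => FImp (x ∈ a) (F x)) <-> forall q x, p ≼ q -> q ⊩ x ∈ a -> q ⊩ F x.
Proof.
  split.
  - intros H q x Q K; specialize (H x); rewrite forces_imp in H; auto.
  - intros H x; apply forces_imp; auto.
Qed.

Lemma f_eq_refl a p : p ⊩ a ≐ a.
Proof.
  revert p; induction a as [I na IH ca]; intros p; split; intros i q Q C q' Q'; exists q';
    (split; [auto |]); exists i; split; eauto; apply IH.
Qed.

Arguments f_eq_refl : clear implicits.

Lemma f_eq_sym a b p : p ⊩ a ≐ b -> p ⊩ b ≐ a.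
Proof.
  revert b p; induction a as [I na IH ca]; intros [J nb cb] p [H1 H2]; split.
  - intros j q Q C q' Q'; destruct (H2 j q Q C q' Q') as (r & R & i & K & L).
    exists r; split; [auto |]; exists i; split; [auto |]; apply IH, L.
  - intros i q Q C q' Q'; destruct (H1 i q Q C q' Q') as (r & R & j & K & L).
    exists r; split; [auto |]; exists j; split; [auto |]; apply IH, L.
Qed.

Lemma f_eq_trans a b c p : p ⊩ a ≐ b -> p ⊩ b ≐ c -> p ⊩ a ≐ c.
Proof.
  revert b c p; induction a as [I na IH ca]; intros [J nb cb] [K nc cc] p [H1 H2] [L1 L2]; split.
  - intros i q Q C q' Q'; destruct (H1 i q Q C q' Q') as (r & R & j & E1 & E2).
    destruct (L1 j r) with (q' := r) as (r' & R' & k & F1 & F2); eauto.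
    exists r'; split; [eauto |]; exists k; split; [auto |].
    apply (IH i (nb j)); [exact (eq_mono R' E2) | exact F2].
  - intros k q Q C q' Q'; destruct (L2 k q Q C q' Q') as (r & R & j & E1 & E2).
    destruct (H2 j r) with (q' := r) as (r' & R' & i & F1 & F2); eauto.
    exists r'; split; [eauto |]; exists i; split; [auto |].
    apply (IH i (nb j)); [exact F2 | exact (eq_mono R' E2)].
Qed.

Lemma mem_intro (I : Type) (nm : I -> name P) (cd : I -> P) i p :
  cd i ≼ p -> p ⊩ nm i ∈ Name nm cd.
Proof. intros H q Q; exists q; split; [auto |]; exists i; split; [eauto | apply f_eq_refl]. Qed.

Lemma mem_congr s t a b p : p ⊩ s ≐ t -> p ⊩ a ≐ b -> p ⊩ s ∈ a -> p ⊩ t ∈ b.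
Proof.
  destruct a as [I na ca], b as [J nb cb]; intros E [H _] K q Q.
  destruct (K q Q) as (r & R & i & C & L).
  destruct (H i r) with (q' := r) as (r' & R' & j & D & M); eauto.
  exists r'; split; [eauto |]; exists j; split; [auto |].
  apply (f_eq_trans (b := na i)); [| exact M].
  apply (f_eq_trans (b := s)); [| exact (eq_mono R' L)].
  apply f_eq_sym; exact (eq_mono (le_tr Q (le_tr R R')) E).
Qed.

Lemma f_ext a b p :
  (forall q s, p ≼ q -> q ⊩ s ∈ a -> q ⊩ s ∈ b) ->
  (forall q s, p ≼ q -> q ⊩ s ∈ b -> q ⊩ s ∈ a) -> p ⊩ a ≐ b.
Proof.
  destruct a as [I na ca], b as [J nb cb]; intros H K; split.
  - intros i q Q C; exact (H q (na i) Q (mem_intro na C)).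
  - intros j q Q C q' Q'; destruct (K q (nb j) Q (mem_intro nb C) q' Q') as (r & R & i & D & L).
    exists r; split; [auto |]; exists i; split; [auto | exact (f_eq_sym L)].
Qed.

(* [fmeq p f g]: [g] arises from [f] by replacing parameters by names that [p]
   forces to be equal to them. *)
Inductive fmeq p : fm (name P) -> fm (name P) -> Prop :=
| fmeq_mem x x' y y' : p ⊩ x ≐ x' -> p ⊩ y ≐ y' -> fmeq p (x ∈ y) (x' ∈ y')
| fmeq_eq x x' y y' : p ⊩ x ≐ x' -> p ⊩ y ≐ y' -> fmeq p (x ≐ y) (x' ≐ y')
| fmeq_not f g : fmeq p f g -> fmeq p (¬ f) (¬ g)
| fmeq_and f f' g g' : fmeq p f f' -> fmeq p g g' -> fmeq p (f ∧ g) (f' ∧ g')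
| fmeq_all F G : (forall x, fmeq p (F x) (G x)) -> fmeq p (FAll F) (FAll G).

(** [FAll] accepts any function from names to formulas, so [F x] and [F y] may be unrelated even
    when [x] and [y] are forced equal. Replacement of equals is therefore proved along a derivation
    of [fmeq]. *)
Lemma fmeq_forces p f g : fmeq p f g -> (p ⊩ f <-> p ⊩ g).
Proof.
  intros H.
  enough (G : forall q, p ≼ q -> (q ⊩ f <-> q ⊩ g)) by auto.
  induction H as [x x' y y' H1 H2 | x x' y y' H1 H2 | f g H IH | f f' g g' H1 IH1 H2 IH2 | F G H IH];
    intros q Q.
  - pose proof (forces_mono Q H1); pose proof (forces_mono Q H2); split; apply mem_congr; auto using f_eq_sym.
  - pose proof (forces_mono Q H1); pose proof (forces_mono Q H2); split; intros L.
    + exact (f_eq_trans (f_eq_trans (f_eq_sym H) L) H0).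
    + exact (f_eq_trans (f_eq_trans H L) (f_eq_sym H0)).
  - simpl; split; intros L r R K; apply (L r R), IH; eauto.
  - simpl; rewrite (IH1 q Q), (IH2 q Q); tauto.
  - simpl; split; intros L x; apply IH; auto.
Qed.

Lemma fmeq_goal p (F : name P -> fm (name P)) x y :
  p ⊩ x ≐ y -> fmeq p (F x) (F y) -> p ⊩ F y -> p ⊩ F x.
Proof. intros _ H; apply fmeq_forces, H. Qed.

Lemma mem_elim (I : Type) (nm : I -> name P) (cd : I -> P) t g p :
  p ⊩ t ∈ Name nm cd ->
  (forall q i, p ≼ q -> cd i ≼ q -> q ⊩ t ≐ nm i -> q ⊩ g) -> p ⊩ g.
Proof.
  intros H K; apply forces_local; intros q Q; destruct (H q Q) as (r & R & i & C & E); eauto 6.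
Qed.

Lemma mem_inv (I : Type) (nm : I -> name P) (cd : I -> P) t p :
  p ⊩ t ∈ Name nm cd -> exists q i, p ≼ q /\ cd i ≼ q /\ q ⊩ t ≐ nm i.
Proof. intros H; destruct (H p (le_refl p)) as (r & R & i & C & E); eauto. Qed.

Lemma set_intro (I : Type) (nm : I -> name P) i p : p ⊩ nm i ∈ set_name nm.
Proof. apply (mem_intro (fun ip : I * P => nm (fst ip)) (cd := fun ip => snd ip) (i := (i, p))); auto. Qed.

Arguments set_intro [I] nm i p.

Lemma set_elim (I : Type) (nm : I -> name P) t g p :
  p ⊩ t ∈ set_name nm -> (forall q i, p ≼ q -> q ⊩ t ≐ nm i -> q ⊩ g) -> p ⊩ g.
Proof. intros H K; apply (mem_elim H); intros q i Q _; apply K, Q. Qed.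

Lemma set_inv (I : Type) (nm : I -> name P) t p :
  p ⊩ t ∈ set_name nm -> exists q i, p ≼ q /\ q ⊩ t ≐ nm i.
Proof. intros H; destruct (mem_inv H) as (q & i & Q & _ & E); eauto. Qed.

Ltac fm_congr := repeat first [assumption | apply f_eq_refl | constructor].
(** Rewrites in a forced goal. The equation must be forced by the same condition as the goal, and
    [fm_congr] builds the derivation of [fmeq]. *)
Ltac fsubst H :=
  lazymatch type of H with forces _ ?r (FEq ?x ?y) =>
    lazymatch goal with |- forces _ r ?phi =>
      let phi' := eval pattern x in phi in
      lazymatch phi' with ?F x =>
        apply (@fmeq_goal r F x y H); [solve [fm_congr] |]; cbv beta
      end end end.

Lemma mem_upair s t w p : p ⊩ w ∈ upair_name s t <-> p ⊩ (w ≐ s ∨ w ≐ t).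
Proof.
  split; intros H.
  - apply (set_elim H); intros q [|] Q E; [apply or_introl', E | apply or_intror', E].
  - apply (or_elim H); intros q Q E; fsubst E.
    + apply (set_intro (fun b : bool => if b then s else t) true).
    + apply (set_intro (fun b : bool => if b then s else t) false).
Qed.

Lemma upairP z s t p : p ⊩ f_upair z s t <-> p ⊩ z ≐ upair_name s t.
Proof.
  split; intros H.
  - apply f_ext; intros q w Q K; specialize (H w); rewrite forces_iff in H;
      apply mem_upair || apply H; auto; [apply H | apply mem_upair in K]; auto.
  - fsubst H; intros w; apply forces_iff; intros q Q; apply mem_upair.
Qed.

Lemma upair_congr s s' t t' p : p ⊩ s ≐ s' -> p ⊩ t ≐ t' -> p ⊩ upair_name s t ≐ upair_name s' t'.
Proof.
  intros H K; apply upairP.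
  apply (fmeq_forces (f := f_upair (upair_name s t) s t)); [fm_congr |].
  apply upairP, f_eq_refl.
Qed.

Lemma opairP z s t p : p ⊩ f_opair z s t <-> p ⊩ z ≐ opair_name s t.
Proof.
  split; intros H.
  - apply (ex_elim H); intros q u Q H1; apply (ex_elim H1); intros r v R (U & V & Z).
    apply upairP in U, V, Z.
    exact (f_eq_trans Z (upair_congr U V)).
  - apply (ex_intro' (x := upair_name s s)), (ex_intro' (x := upair_name s t)).
    split; [| split]; apply upairP; auto using f_eq_refl.
Qed.

Lemma upair_left s t p : p ⊩ s ∈ upair_name s t.
Proof. apply mem_upair, or_introl', f_eq_refl. Qed.

Lemma upair_right s t p : p ⊩ t ∈ upair_name s t.
Proof. apply mem_upair, or_intror', f_eq_refl. Qed.

Arguments upair_left : clear implicits.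
Arguments upair_right : clear implicits.

Lemma mem_eq_r s a b p : p ⊩ a ≐ b -> p ⊩ s ∈ a -> p ⊩ s ∈ b.
Proof. intros H; apply mem_congr; auto using f_eq_refl. Qed.

Lemma or_idem f p : p ⊩ (f ∨ f) -> p ⊩ f.
Proof. intros H; apply (or_elim H); auto. Qed.

Lemma opair_inj_l s t s' t' p : p ⊩ opair_name s t ≐ opair_name s' t' -> p ⊩ s ≐ s'.
Proof.
  intros H; pose proof (mem_eq_r H (upair_left _ _ p)) as K; apply mem_upair in K.
  apply f_eq_sym, or_idem, mem_upair.
  apply (or_elim K); intros q Q E; apply (mem_eq_r (f_eq_sym E)), upair_left.
Qed.

(** Comparing the second members of the pairs gives [t ≐ s'] or [t ≐ t'], and symmetrically [t' ≐ s]
    or [t' ≐ t]. In the crossed case [s ≐ s'] makes all four equal. *)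
Lemma opair_inj_r s t s' t' p : p ⊩ opair_name s t ≐ opair_name s' t' -> p ⊩ t ≐ t'.
Proof.
  intros H; pose proof (opair_inj_l H) as Es.
  assert (K : p ⊩ (t ≐ s' ∨ t ≐ t')).
  { pose proof (mem_eq_r H (upair_right _ _ p)) as K; apply mem_upair in K.
    apply (or_elim K); intros q Q E; pose proof (mem_eq_r E (upair_right _ _ q)) as L;
      apply mem_upair in L; [apply or_introl', or_idem, L | exact L]. }
  assert (K' : p ⊩ (t' ≐ s ∨ t' ≐ t)).
  { pose proof (mem_eq_r (f_eq_sym H) (upair_right _ _ p)) as K'; apply mem_upair in K'.
    apply (or_elim K'); intros q Q E; pose proof (mem_eq_r E (upair_right _ _ q)) as L;
      apply mem_upair in L; [apply or_introl', or_idem, L | exact L]. }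
  apply (or_elim K); intros q Q E; [| exact E].
  apply (or_elim (forces_mono Q K')); intros r R E'; [| exact (f_eq_sym E')].
  apply (f_eq_trans (forces_mono R E)), f_eq_sym, (f_eq_trans E'), (forces_mono (le_tr Q R) Es).
Qed.

Lemma appP a s t p : p ⊩ f_app a s t <-> p ⊩ opair_name s t ∈ a.
Proof.
  split; intros H.
  - apply (ex_elim H); intros q z Q [Z O]; apply opairP in O.
    exact (mem_congr O (f_eq_refl _ _) Z).
  - apply (ex_intro' (x := opair_name s t)); split; [exact H |]; apply opairP, f_eq_refl.
Qed.

Lemma emptyP x p : p ⊩ f_empty x <-> p ⊩ x ≐ check_bool P false.
Proof.
  assert (Z : forall q s, ~ q ⊩ s ∈ check_bool P false).
  { intros q s K; destruct (set_inv K) as (_ & [] & _). }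
  split; intros H.
  - apply f_ext; intros q s Q K; [destruct (H s q Q K) | destruct (Z q s K)].
  - fsubst H; intros z q Q; apply Z.
Qed.

Lemma mem_one x p : p ⊩ x ∈ check_bool P true <-> p ⊩ f_empty x.
Proof.
  split; intros H.
  - apply (set_elim H); intros q i Q E; apply emptyP, E.
  - apply emptyP in H; fsubst H; apply (set_intro (fun _ : unit => check_bool P false) tt).
Qed.

Lemma bit_intro (b : bool) p : p ⊩ f_bit (check_bool P b).
Proof.
  destruct b.
  - apply or_intror'; intros z; apply forces_iff; intros q Q; apply mem_one.
  - apply or_introl', emptyP, f_eq_refl.
Qed.

Lemma bit_elim x g p :
  p ⊩ f_bit x -> (forall q (b : bool), p ≼ q -> q ⊩ x ≐ check_bool P b -> q ⊩ g) -> p ⊩ g.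
Proof.
  intros H K; apply (or_elim H); intros q Q E.
  - apply (K q false Q), emptyP, E.
  - apply (K q true Q), f_ext; intros r s R M; pose proof (E s) as Es; rewrite forces_iff in Es;
      [apply mem_one | apply mem_one in M]; apply Es; auto.
Qed.

Lemma check_bool_inj (b b' : bool) p : p ⊩ check_bool P b ≐ check_bool P b' -> b = b'.
Proof.
  assert (N : forall p, ~ p ⊩ check_bool P true ≐ check_bool P false).
  { intros q H; destruct (set_inv (mem_eq_r H (set_intro (fun _ : unit => check_bool P false) tt q)))
      as (_ & [] & _). }
  destruct b, b'; auto; intros H; [destruct (N p H) | destruct (N p (f_eq_sym H))].
Qed.

(** * Absoluteness for check names of ordinals and binary sequences *)

Section Ord.
Context (W : wellorder).
Local Notation ck := (@check_ord P W).
Local Notation cs := (@check_bseq P W).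
Implicit Types (α β : W) (e n : bseq W).

Lemma check_ord_eq α : ck α = set_name (fun β : {β : W | wo_lt β α} => ck (proj1_sig β)).
Proof. unfold check_ord at 1; rewrite Fix_unfold; reflexivity. Qed.

Lemma ord_intro α β p : wo_lt β α -> p ⊩ ck β ∈ ck α.
Proof.
  intros H; rewrite (check_ord_eq α).
  apply (set_intro (fun β : {β : W | wo_lt β α} => ck (proj1_sig β)) (exist _ β H)).
Qed.

Arguments ord_intro [α β] p _.

Lemma ord_elim α t g p :
  p ⊩ t ∈ ck α -> (forall q β, p ≼ q -> wo_lt β α -> q ⊩ t ≐ ck β -> q ⊩ g) -> p ⊩ g.
Proof.
  rewrite check_ord_eq; intros H K; apply (set_elim H); intros q [β Hβ] Q; apply K; auto.
Qed.

Lemma ord_inv α t p : p ⊩ t ∈ ck α -> exists q β, p ≼ q /\ wo_lt β α /\ q ⊩ t ≐ ck β.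
Proof.
  rewrite check_ord_eq; intros H; destruct (set_inv H) as (q & [β Hβ] & Q & E); eauto.
Qed.

(** A membership of [ck α] in itself yields, at a stronger condition, the same for some smaller
    [β]. *)
Lemma ord_irrefl α p : ~ p ⊩ ck α ∈ ck α.
Proof.
  revert p; induction (wo_wf α) as [α _ IH]; intros p H.
  destruct (ord_inv H) as (q & β & Q & L & E); apply (IH β L q).
  exact (mem_eq_r E (ord_intro q L)).
Qed.

Lemma check_ord_inj α β p : p ⊩ ck α ≐ ck β -> α = β.
Proof.
  intros H; destruct (wo_total α β) as [L | [L | L]]; [| exact L |].
  - destruct (ord_irrefl (mem_eq_r (f_eq_sym H) (ord_intro p L))).
  - destruct (ord_irrefl (mem_eq_r H (ord_intro p L))).
Qed.

Lemma ord_sub α β p : p ⊩ ck β ⊑ ck α <-> β <= α.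
Proof.
  unfold f_sub; rewrite all_in; split.
  - intros H; apply nlt_le; intros L.
    exact (ord_irrefl (H p (ck α) (le_refl p) (ord_intro p L))).
  - intros H q x Q K; apply (ord_elim K); intros r γ R L E; fsubst E.
    apply ord_intro; exact (lt_le_trans L H).
Qed.

Lemma bseq_intro e α p : wo_lt α (lg e) -> p ⊩ opair_name (ck α) (check_bool P (val e α)) ∈ cs e.
Proof.
  intros H; apply (set_intro (fun x : {x : W | wo_lt x (lg e)} =>
    opair_name (ck (proj1_sig x)) (check_bool P (val e (proj1_sig x)))) (exist _ α H)).
Qed.

Arguments bseq_intro [e α] p _.

Lemma bseq_elim e t g p : p ⊩ t ∈ cs e ->
  (forall q α, p ≼ q -> wo_lt α (lg e) ->
     q ⊩ t ≐ opair_name (ck α) (check_bool P (val e α)) -> q ⊩ g) -> p ⊩ g.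
Proof. intros H K; apply (set_elim H); intros q [α Hα] Q; apply K; auto. Qed.

Lemma bseq_inv e t p : p ⊩ t ∈ cs e ->
  exists q α, p ≼ q /\ wo_lt α (lg e) /\ q ⊩ t ≐ opair_name (ck α) (check_bool P (val e α)).
Proof. intros H; destruct (set_inv H) as (q & [α Hα] & Q & E); eauto. Qed.

Lemma bseq_mem_inv e α (b : bool) p :
  p ⊩ opair_name (ck α) (check_bool P b) ∈ cs e -> wo_lt α (lg e) /\ b = val e α.
Proof.
  intros H; destruct (bseq_inv H) as (q & β & Q & L & E).
  pose proof (check_ord_inj (opair_inj_l E)) as ->.
  pose proof (check_bool_inj (opair_inj_r E)) as ->; auto.
Qed.

Lemma bseq_sub e n p : p ⊩ cs e ⊑ cs n <-> prefix e n.
Proof.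
  unfold f_sub; rewrite all_in; split.
  - intros H.
    assert (K : forall α, wo_lt α (lg e) -> wo_lt α (lg n) /\ val e α = val n α).
    { intros α Hα; exact (bseq_mem_inv (H p _ (le_refl p) (bseq_intro p Hα))). }
    apply prefix_intro.
    + apply nlt_le; intros L; exact (lt_irrefl (proj1 (K _ L))).
    + intros x Hx; symmetry; apply K, Hx.
  - intros H q x Q K; apply (bseq_elim K); intros r α R L E; fsubst E.
    rewrite <- (prefix_val H L); apply bseq_intro; exact (lt_le_trans L (proj1 H)).
Qed.

Lemma sub_refl_eq s t p : p ⊩ s ≐ t -> p ⊩ s ⊑ t.
Proof. intros H; apply all_in; intros q x Q; apply mem_eq_r, (forces_mono Q H). Qed.

Lemma check_bseq_inj e n p : p ⊩ cs e ≐ cs n -> e = n.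
Proof.
  intros H; pose proof (proj1 (bseq_sub _ _ _) (sub_refl_eq H)) as H1.
  pose proof (proj1 (bseq_sub _ _ _) (sub_refl_eq (f_eq_sym H))) as H2.
  apply (prefix_lg_eq H1), le_antisym; [apply H1 | apply H2].
Qed.

Lemma app_elim e x y g p : p ⊩ f_app (cs e) x y ->
  (forall q α, p ≼ q -> wo_lt α (lg e) -> q ⊩ x ≐ ck α -> q ⊩ y ≐ check_bool P (val e α) -> q ⊩ g) ->
  p ⊩ g.
Proof.
  intros H K; apply appP in H; apply (bseq_elim H); intros q α Q L E.
  exact (K q α Q L (opair_inj_l E) (opair_inj_r E)).
Qed.

Lemma seq_intro e p : p ⊩ f_seq (cs e) (ck (lg e)).
Proof.
  split; [split; [| split] |].
  - apply all_in; intros q z Q H; apply (bseq_elim H); intros r α R L E.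
    apply (ex_intro' (x := ck α)); split; [apply ord_intro, L |].
    apply (ex_intro' (x := check_bool P (val e α))), opairP, E.
  - apply all_in; intros q x Q H; apply (ord_elim H); intros r α R L E; fsubst E.
    apply (ex_intro' (x := check_bool P (val e α))), appP, bseq_intro, L.
  - intros x y z; apply forces_imp; intros q Q H; apply forces_imp; intros r R K.
    apply (app_elim (forces_mono R H)); intros r1 α R1 L1 E1 F1.
    apply (app_elim (forces_mono R1 K)); intros r2 β R2 L2 E2 F2.
    assert (α = β) as <- by exact (check_ord_inj (f_eq_trans (f_eq_sym (forces_mono R2 E1)) E2)).
    exact (f_eq_trans (forces_mono R2 F1) (f_eq_sym F2)).
  - intros x y; apply forces_imp; intros q Q H; apply (app_elim H); intros r α R L E F; fsubst F.
    apply bit_intro.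
Qed.

Lemma seq_dom e b p : p ⊩ f_seq (cs e) b -> p ⊩ b ≐ ck (lg e).
Proof.
  intros [[H1 [H2 _]] _]; apply f_ext; intros q s Q K.
  - apply (ex_elim (proj1 (all_in _ _ _) H2 q s Q K)); intros r y R A.
    apply (app_elim A); intros r' α R' L E _; fsubst E; apply ord_intro, L.
  - apply (ord_elim K); intros r α R L E; fsubst E.
    apply (ex_elim (proj1 (all_in _ _ _) H1 r _ (le_tr Q R) (bseq_intro r L))).
    intros r1 x R1 [X A]; apply (ex_elim A); intros r2 y R2 O; apply opairP in O.
    exact (mem_congr (f_eq_sym (opair_inj_l O)) (f_eq_refl _ _) (forces_mono R2 X)).
Qed.

(** Initial segments of a ground model sequence are ground model sequences, even when given by
    arbitrary names; this closes the generic tree under initial segments. *)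
Lemma seq_sub_restr e b β p : p ⊩ f_seq b (ck β) -> p ⊩ b ⊑ cs e ->
  β <= lg e /\ p ⊩ b ≐ cs (restr e β).
Proof.
  intros [[H1 [H2 _]] _] S; unfold f_sub in S; rewrite all_in in S, H1, H2.
  (* Totality of [b] gives a pair at [α]; as [b] is included in [e], its value can only be that of
     [e]. *)
  assert (V : forall q α g, p ≼ q -> wo_lt α β ->
     (forall r, q ≼ r -> wo_lt α (lg e) ->
        r ⊩ opair_name (ck α) (check_bool P (val e α)) ∈ b -> r ⊩ g) -> q ⊩ g).
  { intros q α g Q L K; apply (ex_elim (H2 q _ Q (ord_intro q L))); intros r y R A.
    apply appP in A; apply (bseq_elim (S r _ (le_tr Q R) A)); intros r' γ R' L' E.
    pose proof (check_ord_inj (opair_inj_l E)) as <-.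
    apply (K r' (le_tr R R') L'), (mem_congr E (f_eq_refl _ _) (forces_mono R' A)). }
  assert (B : β <= lg e).
  (* [V] produces only forced formulas, so the contradiction is obtained as a forced [¬ (b ≐ b)]. *)
  { apply nlt_le; intros L; enough (F : p ⊩ ¬ (b ≐ b)) by exact (F p (le_refl p) (f_eq_refl b p)).
    apply (V p (lg e)); auto; intros r R M; destruct (lt_irrefl M). }
  split; [exact B |]; apply f_ext; intros q s Q K.
  - apply (ex_elim (H1 q s Q K)); intros r x R [X A]; apply (ex_elim A); intros r1 y R1 O.
    apply opairP in O; apply (ord_elim (forces_mono R1 X)); intros r2 α R2 L E.
    pose proof (le_tr R (le_tr R1 R2)) as R3.
    apply (bseq_elim (S r2 s (le_tr Q R3) (forces_mono R3 K))); intros r4 γ R4 L' E'.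
    assert (α = γ) as <-.
    { apply (@check_ord_inj α γ r4), (f_eq_trans (f_eq_sym (forces_mono R4 E))).
      apply (@opair_inj_l x y (ck γ) (check_bool P (val e γ))).
      exact (f_eq_trans (f_eq_sym (forces_mono (le_tr R2 R4) O)) E'). }
    fsubst E'; rewrite <- (val_restr e L); apply bseq_intro, L.
  - apply (bseq_elim K); intros r α R L E; fsubst E; simpl in L; rewrite (val_restr e L).
    apply (V r α); auto; exact (le_tr Q R).
Qed.

Lemma snoc_intro e i n p : is_snoc e i n -> p ⊩ f_snoc (cs n) (cs e) (ck (lg e)) (check_bool P i).
Proof.
  intros (Su & Pr & V) z; apply forces_iff; intros q Q; split; intros H.
  - apply (bseq_elim H); intros r α R L E.
    destruct (lt_or_le α (lg e)) as [M | [M | M]].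
    + apply or_introl'; fsubst E; rewrite (prefix_val Pr M); apply bseq_intro, M.
    (* No index of [n] lies above [lg e], because [lg n] is its successor. *)
    + destruct (le_nlt (proj2 Su α M) L).
    + apply or_intror', opairP; subst; exact E.
  - apply (or_elim H); intros r R K.
    + exact (proj1 (all_in _ _ _) (proj2 (bseq_sub e n r) Pr) r z (le_refl r) K).
    + apply opairP in K; fsubst K; rewrite <- V; apply bseq_intro, Su.
Qed.

Lemma empty_intro e p : (forall x : W, ~ wo_lt x (lg e)) -> p ⊩ f_empty (cs e).
Proof. intros H z q Q K; destruct (bseq_inv K) as (r & α & _ & L & _); exact (H α L). Qed.

Lemma limit_intro α p : limit_ord α -> p ⊩ f_limit (ck α).
Proof.
  intros [[β Hβ] L].
  assert (T : forall α q, q ⊩ f_trans (ck α)).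
  { intros γ q; apply all_in; intros r x R H; apply (ord_elim H); intros r' δ R' M E; fsubst E.
    apply ord_sub; auto. }
  split; [apply T |]; split; [| split].
  - apply all_in; intros q x Q H; apply (ord_elim H); intros r γ R M E; fsubst E; apply T.
  - apply (ex_intro' (x := ck β)), ord_intro, Hβ.
  - apply all_in; intros q x Q H; apply (ord_elim H); intros r γ R M E; fsubst E.
    destruct (L γ M) as (δ & D1 & D2); apply (ex_intro' (x := ck δ)); split; apply ord_intro; auto.
Qed.

(** * The generic tree *)

(* [ct p] is the part of the generic tree decided by [p]; for [Q] it is [ctree p]. *)
Section GenericTree.
Variables (lam : W) (ct : P -> bseq W -> Prop).
Hypothesis lam_limit : limit_ord lam.
Hypothesis ct_mono : forall p q e, p ≼ q -> ct p e -> ct q e.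
Hypothesis ct_lg : forall p e, ct p e -> wo_lt (lg e) lam.
Hypothesis ct_root : forall p, exists e, ct p e /\ forall α, ~ wo_lt α (lg e).
Hypothesis ct_prefix : forall p e n, ct p e -> prefix n e -> ct p n.
Hypothesis ct_snoc : forall p e i, ct p e -> exists n, ct p n /\ is_snoc e i n.
Hypothesis ct_ext : forall p e α, ct p e -> lg e <= α -> wo_lt α lam ->
  exists r n, p ≼ r /\ ct r n /\ lg n = α /\ prefix e n.
Hypothesis ct_size : forall p, size_lt (ct p) lam.
Hypothesis ct_seal : forall AA : P -> bseq W -> Prop,
  (forall p q e, p ≼ q -> AA p e -> AA q e) ->
  (forall p e n, AA p e -> AA p n -> prefix e n -> e = n) ->
  (forall p e, AA p e -> exists r, p ≼ r /\ ct r e) ->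
  forall p, exists w, p ≼ w /\ forall r e, w ≼ r -> AA r e -> ct w e.

Local Notation Tn := (Name (fun pe : {p : P & {e : bseq W | ct p e}} => cs (proj1_sig (projT2 pe)))
                           (fun pe => projT1 pe)).
Local Notation Gn := (Name (fun p : P => check_set P (ct p)) (fun p => p)).

Lemma tree_intro p e : ct p e -> p ⊩ cs e ∈ Tn.
Proof.
  intros H.
  apply (mem_intro (fun pe : {p : P & {e : bseq W | ct p e}} => cs (proj1_sig (projT2 pe)))
           (cd := fun pe => projT1 pe) (i := existT _ p (exist _ e H))); simpl; auto.
Qed.

Lemma tree_elim t g p : p ⊩ t ∈ Tn ->
  (forall q e, p ≼ q -> ct q e -> q ⊩ t ≐ cs e -> q ⊩ g) -> p ⊩ g.
Proof.
  intros H K; apply (mem_elim H); intros q [p' [e He]] Q C E; simpl in *; eauto.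
Qed.

Lemma tree_inv e p : p ⊩ cs e ∈ Tn -> exists r, p ≼ r /\ ct r e.
Proof.
  intros H; destruct (mem_inv H) as (q & [p' [n Hn]] & Q & C & E); simpl in *.
  rewrite (check_bseq_inj E); eauto.
Qed.

Lemma generic_union p : p ⊩ f_union Tn Gn.
Proof.
  intros z; apply forces_iff; intros q Q; split; intros H.
  - apply (tree_elim H); intros r e R He E.
    apply (ex_intro' (x := check_set P (ct r))); split.
    + apply (mem_intro (fun p : P => check_set P (ct p)) (cd := fun p => p) (i := r)); auto.
    + fsubst E.
      apply (set_intro (fun e : {e : bseq W | ct r e} => cs (proj1_sig e)) (exist _ e He)).
  - apply (ex_elim H); intros r t R [Ht Hz]; apply (mem_elim Ht); intros r1 p' R1 C E.
    apply (set_elim (mem_eq_r E (forces_mono R1 Hz))); intros r2 [e He] R2 E2; change (r2 ⊩ z ≐ cs e) in E2.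
    fsubst E2; apply tree_intro; apply (ct_mono (p := p')); eauto.
Qed.

Lemma generic_is_tree p : p ⊩ f_tree (ck lam) Tn.
Proof.
  split; [apply limit_intro, lam_limit |]; split; [| split; [| split; [| split]]].
  - apply all_in; intros q x Q H; apply (tree_elim H); intros r e R He E; fsubst E.
    apply (ex_intro' (x := ck (lg e))); split; [apply ord_intro, (ct_lg He) | apply seq_intro].
  - destruct (ct_root p) as (e & He & Ee).
    apply (ex_intro' (x := cs e)); split; [apply tree_intro, He | apply empty_intro, Ee].
  - apply all_in; intros q x Q H; apply (tree_elim H); intros r e R He E; fsubst E.
    intros n; apply forces_imp; intros r1 R1 N; apply forces_imp; intros r2 R2 S.
    apply (ex_elim (forces_mono R2 N)); intros r3 b R3 [B Sq].
    apply (ord_elim B); intros r4 β R4 _ Eb.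
    assert (Sq' : r4 ⊩ f_seq n (ck β)).
    { pose proof (f_eq_sym Eb) as Eb'; fsubst Eb'; exact (forces_mono R4 Sq). }
    destruct (seq_sub_restr Sq' (forces_mono (le_tr R3 R4) S)) as [L En]; fsubst En.
    apply tree_intro, (ct_prefix (e := e)); [| apply prefix_restr, L].
    apply (ct_mono (p := r)); eauto.
  - apply all_in; intros q x Q H; apply (tree_elim H); intros r e R He E; fsubst E.
    intros b; apply forces_imp; intros r1 R1 Sq; apply seq_dom in Sq; fsubst Sq.
    intros i; apply forces_imp; intros r2 R2 B; apply (bit_elim B); intros r3 j R3 Ei; fsubst Ei.
    destruct (ct_snoc j (ct_mono (le_tr R1 (le_tr R2 R3)) He)) as (n & N1 & N2).
    apply (ex_intro' (x := cs n)); split; [apply tree_intro, N1 | apply snoc_intro, N2].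
  - apply all_in; intros q x Q H; apply (tree_elim H); intros r e R He E; fsubst E.
    intros b; apply forces_imp; intros r1 R1 Sq; apply seq_dom in Sq; fsubst Sq.
    apply all_in; intros r2 c R2 C; apply (ord_elim C); intros r3 γ R3 L Ec; fsubst Ec.
    apply forces_imp; intros r4 R4 S; apply ord_sub in S.
    (* Level [γ] may not exist yet; a stronger condition has to supply the node. *)
    apply forces_local; intros r5 R5.
    destruct (ct_ext (ct_mono (le_tr R1 (le_tr R2 (le_tr R3 (le_tr R4 R5)))) He) S L)
      as (r6 & n & R6 & N1 & N2 & N3).
    exists r6; split; [exact R6 |]; apply (ex_intro' (x := cs n)).
    split; [apply tree_intro, N1 |]; split; [rewrite <- N2; apply seq_intro | apply bseq_sub, N3].
Qed.

(** Sealing confines [A] to the nodes of one condition [w], a set that the ground model injects by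
    [h] into some [β < lam]. The required function is [h] restricted to [A], given by a name
    although [A] need not be decided. *)
Lemma antichain_small A p : p ⊩ f_antichain Tn A -> p ⊩ f_size_lt A (ck lam).
Proof.
  intros [HT HA]; unfold f_sub in HT; rewrite all_in in HT, HA.
  apply forces_local; intros q0 Q0.
  (* The clause [p ≼ r] is there because [A] is known to be an antichain of the tree only above
     [p]. *)
  destruct (ct_seal (AA := fun r e => p ≼ r /\ r ⊩ cs e ∈ A)) with (p := q0) as (w & Pw & Hw).
  { intros q r e R [Q H]; split; [eauto | exact (forces_mono R H)]. }
  { intros q e n [Q H] [_ K] Pr; apply (@check_bseq_inj e n q).
    pose proof (proj1 (all_in _ _ _) (HA q _ Q H) q _ (le_refl q) K) as I.
    rewrite forces_imp in I; apply I; [auto |]; apply bseq_sub, Pr. }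
  { intros q e [Q H]; exact (tree_inv (HT q _ Q H)). }
  exists w; split; [exact Pw |]; pose proof (le_tr Q0 Pw) as Qw.
  destruct (ct_size w) as (β & Hβ & h & h1 & h2).
  assert (A_elim : forall q x g, w ≼ q -> q ⊩ x ∈ A ->
     (forall r e, q ≼ r -> ct w e -> r ⊩ cs e ∈ A -> r ⊩ x ≐ cs e -> r ⊩ g) -> q ⊩ g).
  { intros q x g Q H K; apply (tree_elim (HT q x (le_tr Qw Q) H)); intros r e R _ E.
    pose proof (mem_congr E (f_eq_refl A r) (forces_mono R H)) as M.
    apply (K r e R); auto; apply (Hw r e); [eauto |]; split; [eauto | exact M]. }
  (* The pair for [e] enters with a condition that forces [e] into [A], so the domain is forced to
     be exactly [A]. *)
  set (nm := fun i : {er : bseq W * P | ct w (fst er) /\ snd er ⊩ cs (fst er) ∈ A} =>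
    opair_name (cs (fst (proj1_sig i))) (ck (h (fst (proj1_sig i))))).
  set (F := Name nm (fun i => snd (proj1_sig i))).
  assert (F_intro : forall q e, ct w e -> q ⊩ cs e ∈ A -> q ⊩ opair_name (cs e) (ck (h e)) ∈ F).
  { intros q e He H.
    apply (mem_intro nm (cd := fun i => snd (proj1_sig i)) (i := exist _ (e, q) (conj He H))).
    apply le_refl. }
  assert (F_elim : forall q t g, q ⊩ t ∈ F ->
     (forall r e, q ≼ r -> ct w e -> r ⊩ cs e ∈ A -> r ⊩ t ≐ opair_name (cs e) (ck (h e)) -> r ⊩ g) ->
     q ⊩ g).
  { intros q t g H K; apply (mem_elim H); intros r [[e r0] [He M]] R C E.
    exact (K r e R He (forces_mono C M) E). }
  assert (F_app : forall q x y g, q ⊩ f_app F x y ->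
     (forall r e, q ≼ r -> ct w e -> r ⊩ x ≐ cs e -> r ⊩ y ≐ ck (h e) -> r ⊩ g) -> q ⊩ g).
  { intros q x y g H K; apply appP in H; apply (F_elim _ _ _ H); intros r e R He _ E.
    exact (K r e R He (opair_inj_l E) (opair_inj_r E)). }
  clearbody F; clear nm.
  apply (ex_intro' (x := ck β)); split; [apply ord_intro, Hβ |].
  apply (ex_intro' (x := F)); split; [split; [| split] | split].
  - apply all_in; intros q z Q H; apply (F_elim _ _ _ H); intros r e R He M E.
    apply (ex_intro' (x := cs e)); split; [exact M |].
    apply (ex_intro' (x := ck (h e))), opairP, E.
  - apply all_in; intros q x Q H; apply (A_elim _ _ _ Q H); intros r e R He M E; fsubst E.
    apply (ex_intro' (x := ck (h e))), appP, F_intro; auto.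
  - intros x y z; apply forces_imp; intros q Q H; apply forces_imp; intros r R K.
    apply (F_app _ _ _ _ (forces_mono R H)); intros r1 e R1 He E1 E2.
    apply (F_app _ _ _ _ (forces_mono R1 K)); intros r2 n R2 Hn N1 N2.
    assert (e = n) as <- by exact (check_bseq_inj (f_eq_trans (f_eq_sym (forces_mono R2 E1)) N1)).
    exact (f_eq_trans (forces_mono R2 E2) (f_eq_sym N2)).
  - intros x y; apply forces_imp; intros q Q H; apply (F_app _ _ _ _ H); intros r e R He _ E; fsubst E.
    apply ord_intro, h1, He.
  - intros x y z; apply forces_imp; intros q Q H; apply forces_imp; intros r R K.
    apply (F_app _ _ _ _ (forces_mono R H)); intros r1 e R1 He E1 E2.
    apply (F_app _ _ _ _ (forces_mono R1 K)); intros r2 n R2 Hn N1 N2.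
    assert (e = n) as <-.
    { apply h2; auto; exact (check_ord_inj (f_eq_trans (f_eq_sym (forces_mono R2 E2)) N2)). }
    exact (f_eq_trans (forces_mono R2 E1) (f_eq_sym N1)).
Qed.

Lemma generic_souslin p : p ⊩ f_souslin (ck lam) Tn.
Proof.
  split; [apply generic_is_tree |]; intros A; apply forces_imp; intros q _; apply antichain_small.
Qed.

End GenericTree.
End Ord.
End Calculus.

(** * Application to the forcing with trees *)

Lemma node_ext_dense (W : wellorder) (lam : W) (p : cond lam) (e : bseq W) (a : W) :
  strongly_inaccessible lam -> ctree p e -> lg e <= a -> a < lam ->
  exists r n, cond_le p r /\ ctree r n /\ lg n = a /\ prefix e n.
Proof.
  intros (Lw & Reg & _) He L Ha.
  assert (exists r, cond_le p r /\ a < cht r) as (r & R & H).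
  { destruct (lt_or_le a (cht p)) as [M | M]; [exists p; split; [apply cond_le_refl | exact M] |].
    destruct (limits_unbounded Reg Lw Ha) as (h & H1 & H2 & H3).
    destruct (plus_full_exists H1 H3 (le_lt_trans M H2)) as (r & R1 & R2 & _).
    exists r; rewrite R2; auto. }
  destruct (ctree_ext (cond_le_sub R He) L H) as (n & N1 & N2 & N3); exists r, n; auto.
Qed.

Theorem theorem1p7 (W : wellorder) (lam : W) (S S0 : W -> Prop)
  (lam_Mahlo : strongly_inaccessible lam /\ Mahlo lam)
  (S_inacc : forall mu, S mu -> wo_lt mu lam /\ strongly_inaccessible mu)
  (S_stat : stationary lam S)
  (S0_limit : forall d, S0 d -> wo_lt d lam /\ limit_ord d)
  (S_diamond : forall mu, S mu -> diamond mu (fun d => S0 d /\ wo_lt d mu)) :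
  Q_forced (f_union (generic_tree lam) (generic_filter lam)) /\
  Q_forced (f_souslin (check_ord (cond lam) lam) (generic_tree lam)).
Proof.
  destruct lam_Mahlo as [Inacc _].
  assert (mono : forall (p q : cond lam) e, cond_le p q -> ctree p e -> ctree q e).
  { intros p q e; apply cond_le_sub. }
  split; intros p.
  (* For [ct := ctree] the names of the abstract section unfold to [generic_tree] and
     [generic_filter]. *)
  - apply (@generic_union (cond lam) (@cond_le W lam) (@cond_le_refl W lam) (@cond_le_trans W lam)
             W (@ctree W lam) mono).
  - apply (@generic_souslin (cond lam) (@cond_le W lam) (@cond_le_refl W lam) (@cond_le_trans W lam)
             W lam (@ctree W lam)).
    + apply Inacc.
    + exact mono.
    + intros q e He; exact (wo_trans (ctree_lg He) (cht_lt q)).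
    + intros q; apply (ctree_tree q).
    + intros q e n; apply ctree_prefix.
    + intros q e i; apply (ctree_tree q).
    + intros q e a; apply (node_ext_dense Inacc).
    + intros q; destruct Inacc as (_ & _ & SL).
      destruct (short_bseq_size SL (cht_lt q)) as (b & Hb & f & f1 & f2).
      exists b; split; [exact Hb |]; exists f; split; auto using ctree_lg.
    + intros AA H1 H2 H3; exact (antichain_sealed H1 H2 H3 Inacc S_inacc S_stat S_diamond).
Qed.
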